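(* Let $d\ge1$, $\rho\in(\tfrac12,1]$ and let $X,Y\in C^\rho_0([0,1]^2,\mathbb{R}^d)$ with $X\ne Y$. Then there exist integers $n,m,p\ge0$ and $\omega\in\mathcal{M}^{n,m,p}(\mathbb{R}^{d+2})$ such that $$H^\omega(\overline X)\neq H^\omega(\overline Y).$$
   Context: **Hölder surfaces.** For $X:[0,1]^2\to\mathbb{R}^D$ continuous and $R=[s_1,s_2]\times[t_1,t_2]$ put $\square_R[X]=X_{s_1,t_1}-X_{s_1,t_2}-X_{s_2,t_1}+X_{s_2,t_2}$. $C^\rho([0,1]^2,\mathbb{R}^D)$ is the space of $X$ for which $\|X\|_\infty$, $\sup\frac{|X_{s_1,t}-X_{s_2,t}|}{|s_1-s_2|^\rho}$, $\sup\frac{|X_{s,t_1}-X_{s,t_2}|}{|t_1-t_2|^\rho}$ and $\sup\frac{|\square_R[X]|}{|s_1-s_2|^\rho|t_1-t_2|^\rho}$ are all finite; $C_0^\rho$ is the subspace with $X_{0,0}=0$. The parametrized surface of $X$ is $\overline X_{s,t}=(s,t,X_{s,t})\in\mathbb{R}^{d+2}$. **Matrix 2-connections.** Let $n,m,p\ge0$ be integers and $\phi=\begin{pmatrix}I_n&0\\0&0\end{pmatrix}\in\mathrm{Mat}_{n+p,n+m}$. $\mathcal{M}^{n,m,p}(\mathbb{R}^D)$ is the set of triples $\omega=(\alpha,\beta,\gamma)$ with $\alpha=\sum_i\alpha^i dx_i$, $\beta=\sum_i\beta^i dx_i$, $\gamma=\sum_{i<j}\gamma^{i,j}dx_i\wedge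 dx_j$, where $$\alpha^i=\begin{pmatrix}A^i&0\\ B^i&C^i\end{pmatrix},\quad \beta^i=\begin{pmatrix}A^i&D^i\\0&E^i\end{pmatrix},\quad \gamma^{i,j}=\begin{pmatrix}R^{i,j}&S^{i,j}\\ T^{i,j}&U^{i,j}\end{pmatrix},$$ with real blocks $A^i\in\mathrm{Mat}_{n,n}$, $B^i\in\mathrm{Mat}_{m,n}$, $C^i\in\mathrm{Mat}_{m,m}$, $D^i\in\mathrm{Mat}_{n,p}$, $E^i\in\mathrm{Mat}_{p,p}$, $U^{i,j}\in\mathrm{Mat}_{m,p}$ such that for all $i<j$: $[C^i,C^j]=[E^i,E^j]=0$, $R^{i,j}=[A^i,A^j]$, $S^{i,j}=A^iD^j-A^jD^i+D^iE^j-D^jE^i$, $T^{i,j}=B^iA^j-B^jA^i+C^iB^j-C^jB^i$. Coordinates of $\mathbb{R}^{d+2}$ are indexed $s,t,1,\dots,d$. **Surface development.** For a $\rho$-Hölder path $x:[0,1]\to\mathbb{R}^D$ and a matrix-valued 1-form $\alpha$, $F^\alpha(x)=F_1$ where $dF_t=F_t\,\alpha(dx_t)$, $F_0=I$ (Young sense). For $X\in C^\rho([0,1]^2,\mathbb{R}^D)$ the tail path $x^{s,t}$ is $u\mapsto X_{0,2ut}$ for $u\in[0,\frac12]$ and $u\mapsto X_{(2u-1)s,t}$ for $u\in(\frac12,1]$. The area process has components $A^{i,j}_{s,t}(X)=\int_{0<u_1<u_2<1}dy^i_{u_1}dy^j_{u_2}$, where $y$ is the counterclockwise boundary loop (bottom,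 right, upper reversed, left reversed) of $X|_{[0,s]\times[0,t]}$. Put $Z^\omega_{s,t}(X)=\sum_{i<j}\int_0^t\int_0^sF^\alpha(x^{s',t'})\,\gamma^{i,j}\,F^\beta(x^{s',t'})^{-1}\,dA^{i,j}_{s',t'}(X)$ (2D Young integral), and $H^\omega(X)=h_1\in\mathrm{Mat}_{n+m,n+p}$ where $dh_t=(I+h_t\phi)\,dZ^\omega_{1,t}(X)$, $h_0=0$. *)

(* Defs.v *)
From mathcomp Require Import all_boot all_order all_algebra.
From mathcomp Require Import all_classical all_reals all_analysis.
Set Implicit Arguments.
Unset Strict Implicit.
Unset Printing Implicit Defensive.
Import Order.TTheory GRing.Theory Num.Theory.
Import numFieldNormedType.Exports.
Local Open Scope classical_set_scope.
Local Open Scope ring_scope.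

(* Paths and surfaces are total functions on R and R * R; only their values on
   [0, 1] and [0, 1]^2 are ever used. *)

(* A partition a = p_0 < ... < p_k = b is, as in itv_partition, represented by
   the sequence s = [:: p_1; ...; p_k], so that p_i = part_pt a s i. *)
Definition part_pt (R : realType) (a : R) (s : seq R) (i : nat) : R :=
  nth a (a :: s) i.

(* Partitions of [a, b] with mesh tending to 0. *)
Definition mesh_filter (R : realType) (a b : R) : set_system (seq R) :=
  filter_from [set e : R | 0 < e]
    (fun e => [set s | itv_partition a b s /\
       forall i, (i < size s)%N -> part_pt a s i.+1 - part_pt a s i < e]).

Definition young_sum (R : realType) (U : Type) (V W : zmodType)
    (op : U -> V -> W) (f : R -> U) (g : R -> V) (a : R) (s : seq R) : W :=
  \sum_(0 <= i < size s)
    op (f (part_pt a s i)) (g (part_pt a s i.+1) - g (part_pt a s i)).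

(* The integral of op (f u) (dg_u) over [a, b] exists and is equal to w. *)
Definition is_young_int (R : realType) (U : Type) (V : zmodType)
    (W : normedModType R) (op : U -> V -> W) (f : R -> U) (g : R -> V)
    (a b : R) (w : W) : Prop :=
  young_sum op f g a @ mesh_filter a b --> w.

Definition young_int (R : realType) (U : Type) (V : zmodType)
    (W : normedModType R) (op : U -> V -> W) (f : R -> U) (g : R -> V)
    (a b : R) : W :=
  lim (young_sum op f g a @ mesh_filter a b).

Definition square_incr (R : realType) (V : zmodType) (g : R -> R -> V)
    (s1 s2 t1 t2 : R) : V :=
  g s1 t1 - g s1 t2 - g s2 t1 + g s2 t2.

Definition young_sum2 (R : realType) (V : normedModType R)
    (f : R -> R -> V) (g : R -> R -> R) (a a' : R) (P : seq R * seq R) : V :=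
  \sum_(0 <= i < size P.1) \sum_(0 <= j < size P.2)
    square_incr g (part_pt a P.1 i) (part_pt a P.1 i.+1)
                  (part_pt a' P.2 j) (part_pt a' P.2 j.+1)
      *: f (part_pt a P.1 i) (part_pt a' P.2 j).

Definition young_int2 (R : realType) (V : normedModType R)
    (f : R -> R -> V) (g : R -> R -> R) (a b a' b' : R) : V :=
  lim (young_sum2 f g a a' @ filter_prod (mesh_filter a b) (mesh_filter a' b')).

Definition holder_path (R : realType) (V : normedModType R) (rho : R)
    (x : R -> V) : Prop :=
  exists M : R, forall u v : R, u \in `[0, 1] -> v \in `[0, 1] ->
    `|x u - x v| <= M * `|u - v| `^ rho.

(* Finite-dimensional norms being equivalent, the sup norm of 'rV[R]_D gives
   the same space as the Euclidean one. *)
Definition holder_surface (R : realType) (D : nat) (rho : R)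
    (X : R -> R -> 'rV[R]_D) : Prop :=
  {within `[0, 1] `*` `[0, 1], continuous (fun z : R * R => X z.1 z.2)} /\
  exists M : R,
    [/\ forall s t : R, s \in `[0, 1] -> t \in `[0, 1] -> `|X s t| <= M,
        forall s1 s2 t : R, s1 \in `[0, 1] -> s2 \in `[0, 1] -> t \in `[0, 1] ->
          `|X s1 t - X s2 t| <= M * `|s1 - s2| `^ rho,
        forall s t1 t2 : R, s \in `[0, 1] -> t1 \in `[0, 1] -> t2 \in `[0, 1] ->
          `|X s t1 - X s t2| <= M * `|t1 - t2| `^ rho
      & forall s1 s2 t1 t2 : R, s1 \in `[0, 1] -> s2 \in `[0, 1] ->
          t1 \in `[0, 1] -> t2 \in `[0, 1] ->
          `|square_incr X s1 s2 t1 t2|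
            <= M * (`|s1 - s2| `^ rho * `|t1 - t2| `^ rho)].

Definition holder_surface0 (R : realType) (D : nat) (rho : R)
    (X : R -> R -> 'rV[R]_D) : Prop :=
  holder_surface rho X /\ X 0 0 = 0.

(* (s, t) |-> (s, t, X_{s,t}); coordinates 0 and 1 are s and t. *)
Definition param_surface (R : realType) (d : nat) (X : R -> R -> 'rV[R]_d)
    (s t : R) : 'rV[R]_(2 + d) :=
  row_mx (s%:M : 'rV_1) (row_mx (t%:M : 'rV_1) (X s t)).

(* gamma i j is the coefficient of dx_i /\ dx_j and is used for i < j only. *)
Definition is_mx_2connection (R : realType) (D n m p : nat)
    (alpha : 'I_D -> 'M[R]_(n + m)) (beta : 'I_D -> 'M[R]_(n + p))
    (gamma : 'I_D -> 'I_D -> 'M[R]_(n + m, n + p)) : Prop :=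
  exists (A : 'I_D -> 'M[R]_(n, n)) (B : 'I_D -> 'M[R]_(m, n))
         (C : 'I_D -> 'M[R]_(m, m)) (D' : 'I_D -> 'M[R]_(n, p))
         (E : 'I_D -> 'M[R]_(p, p)) (U : 'I_D -> 'I_D -> 'M[R]_(m, p)),
    [/\ forall i, alpha i = block_mx (A i) 0 (B i) (C i),
        forall i, beta i = block_mx (A i) (D' i) 0 (E i),
        forall i j : 'I_D, (i < j)%N -> C i *m C j - C j *m C i = 0,
        forall i j : 'I_D, (i < j)%N -> E i *m E j - E j *m E i = 0
      & forall i j : 'I_D, (i < j)%N ->
          gamma i j = block_mx
            (A i *m A j - A j *m A i)
            (A i *m D' j - A j *m D' i + D' i *m E j - D' j *m E i)
            (B i *m A j - B j *m A i + C i *m B j - C j *m B i)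
            (U i j)].

Record mx_2connection (R : realType) (D n m p : nat) := Mx2Connection {
  conn_alpha : 'I_D -> 'M[R]_(n + m);
  conn_beta : 'I_D -> 'M[R]_(n + p);
  conn_gamma : 'I_D -> 'I_D -> 'M[R]_(n + m, n + p);
  conn_axiom : is_mx_2connection conn_alpha conn_beta conn_gamma }.

Definition conn_phi (R : realType) (n m p : nat) : 'M[R]_(n + p, n + m) :=
  block_mx 1%:M 0 0 0.

(* alpha(v) = sum_i v_i alpha^i, so that d(apply_form alpha x_t) = alpha(dx_t) *)
Definition apply_form (R : realType) (D k : nat) (alpha : 'I_D -> 'M[R]_k)
    (v : 'rV[R]_D) : 'M[R]_k :=
  \sum_(i < D) v 0 i *: alpha i.

(* dF_t = F_t alpha(dx_t), F_0 = I, on [0, 1]; a Young solution is sought among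
   rho-Hölder paths. *)
Definition solves_path_dev (R : realType) (D k : nat) (rho : R)
    (alpha : 'I_D -> 'M[R]_k) (x : R -> 'rV[R]_D) (F : R -> 'M[R]_k) : Prop :=
  [/\ holder_path rho F, F 0 = 1%:M
    & forall t : R, t \in `[0, 1] ->
        is_young_int mulmx F (fun u => apply_form alpha (x u)) 0 t
          (F t - 1%:M)].

(* The solution is unique when x is rho-Hölder and rho > 1/2, so that xget
   really returns its value at time 1. *)
Definition path_dev (R : realType) (D k : nat) (rho : R)
    (alpha : 'I_D -> 'M[R]_k) (x : R -> 'rV[R]_D) : 'M[R]_k :=
  xget 0 [set F 1 | F in [set F | solves_path_dev rho alpha x F]].

Definition tail_path (R : realType) (D : nat) (X : R -> R -> 'rV[R]_D)
    (s t u : R) : 'rV[R]_D :=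
  if u <= 2^-1 then X 0 (2 * u * t) else X ((2 * u - 1) * s) t.

(* The four sides are each run through in time 1/4. *)
Definition boundary_loop (R : realType) (D : nat) (X : R -> R -> 'rV[R]_D)
    (s t u : R) : 'rV[R]_D :=
  if u <= 4^-1 then X (4 * u * s) 0
  else if u <= 2^-1 then X s ((4 * u - 1) * t)
  else if u <= 3 / 4 then X ((3 - 4 * u) * s) t
  else X 0 ((4 - 4 * u) * t).

Definition area_process (R : realType) (D : nat) (X : R -> R -> 'rV[R]_D)
    (i j : 'I_D) (s t : R) : R :=
  let y k u := boundary_loop X s t u 0 k in
  young_int (W := R^o) (@GRing.mul R)
    (fun u2 => young_int (W := R^o) (@GRing.mul R) (fun=> 1) (y i) 0 u2)
    (y j) 0 1.

Definition surface_Z (R : realType) (D n m p : nat) (rho : R)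
    (w : mx_2connection R D n m p) (X : R -> R -> 'rV[R]_D) (s t : R) :
    'M[R]_(n + m, n + p) :=
  \sum_(i < D) \sum_(j < D | (i < j)%N)
    young_int2
      (fun s' t' => path_dev rho (conn_alpha w) (tail_path X s' t')
        *m conn_gamma w i j
        *m invmx (path_dev rho (conn_beta w) (tail_path X s' t')))
      (area_process X i j) 0 s 0 t.

(* dh_t = (I + h_t phi) dZ_{1,t}, h_0 = 0, on [0, 1] *)
Definition solves_surface_dev (R : realType) (D n m p : nat) (rho : R)
    (w : mx_2connection R D n m p) (X : R -> R -> 'rV[R]_D)
    (h : R -> 'M[R]_(n + m, n + p)) : Prop :=
  [/\ holder_path rho h, h 0 = 0
    & forall t : R, t \in `[0, 1] ->
        is_young_int mulmx (fun u => 1%:M + h u *m conn_phi R n m p)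
          (surface_Z rho w X 1) 0 t (h t)].

Definition surface_dev (R : realType) (D n m p : nat) (rho : R)
    (w : mx_2connection R D n m p) (X : R -> R -> 'rV[R]_D) :
    'M[R]_(n + m, n + p) :=
  xget 0 [set h 1 | h in [set h | solves_surface_dev rho w X h]].

(* Main.v *)
Require Import Defs.
From mathcomp Require Import all_boot all_order all_algebra.
From mathcomp Require Import all_classical all_reals all_analysis.
From mathcomp Require Import ring lra.
Import Order.TTheory GRing.Theory Num.Theory.
Import numFieldNormedType.Exports.
Local Open Scope classical_set_scope.
Local Open Scope ring_scope.

(* Take n = 0, m = 1, p = 2.  Since phi = 0, the surface development is the 2D
   Young integral Z_{1,1} itself.  Let alpha be the scalar form a ds + b dt, let
   beta = N dx_i with N nilpotent of order two, and let gamma be carried by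
   ds /\ dt alone, whose area process is A_{s,t} = s t.  Then
   F^alpha(x^{s,t}) = exp(a s + b t) and F^beta(x^{s,t})^-1 = 1 - X^i_{s,t} N, so
   one entry of H is minus the integral of exp(a s + b t) X^i_{s,t} ds dt.
   These Laplace transforms, for natural a and b, determine the continuous
   function X^i.  The only path-development equations to be solved have either a
   Lipschitz driver or a nilpotent one, for which the Young sums telescope, so
   that no Young-Loeve estimate is needed. *)

(** [path_dev] and [surface_dev] are picked by [xget] among end values of solutions, so every
    evaluation requires a solution together with uniqueness of its end value; this obstacle shapes
    the choice of forms. With [n = 0] the blocks of [gamma] forced by the connection axioms are
    empty and the free block carries everything. The size [p = 2] is the smallest with a nonzero
    nilpotent matrix, which makes the development in the rough direction affine in [X], with an
    equally explicit inverse. The scalar form sees only the smooth coordinates, and nonnegative [a]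
    and [b] make its driver nondecreasing. The Laplace transform is inverted one variable at a time:
    in [t] for each exponent [a], then in [s] for fixed [t]. In one variable, powers of a quadratic
    polynomial in [expR x] that peaks at a given point take the role of the Stone-Weierstrass
    theorem. *)

(** * Partitions, the mesh filter and convergence of Young sums *)

Section Partitions.
Set Implicit Arguments.
Unset Strict Implicit.
Context {R : realType}.
Implicit Types (a b u v e : R) (s : seq R).

Lemma part_ptS a x s i : (i <= size s)%N ->
  part_pt a (x :: s) i.+1 = part_pt x s i.
Proof. by move=> ?; rewrite /part_pt/=; apply: set_nth_default. Qed.

Lemma part_pt_last a b s : itv_partition a b s -> part_pt a s (size s) = b.
Proof. by case=> _ /eqP <-; rewrite /part_pt nth_last. Qed.

Lemma part_pt_lt a b s i : itv_partition a b s -> (i < size s)%N ->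
  part_pt a s i < part_pt a s i.+1.
Proof. by case=> /(pathP a) h _ /h. Qed.

Lemma part_pt_itv a b s i : itv_partition a b s -> (i <= size s)%N ->
  a <= part_pt a s i <= b.
Proof.
move=> pt si; rewrite /part_pt (set_nth_default b)//.
by rewrite itv_partition_nth_ge// itv_partition_nth_le.
Qed.

Definition mesh_lt a s e :=
  forall i, (i < size s)%N -> part_pt a s i.+1 - part_pt a s i < e.

(** Properness of the mesh filter rests on this. The induction counts half-steps: pieces of length
    [e / 2] keep the mesh strictly below [e], and a remainder shorter than [e] is a single piece, or
    none if it is a point. *)
Lemma mesh_partition_exists a b e : a <= b -> 0 < e ->
  exists2 s, itv_partition a b s & mesh_lt a s e.
Proof.
move=> ab e0; have [N hN] : exists N, b - a < N%:R * (e / 2).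
  exists (Num.truncn ((b - a) / (e / 2))).+1.
  by rewrite -ltr_pdivrMr ?divr_gt0// truncnS_gt.
elim: N a ab hN => [|N IH] a ab hN; first by move: hN; rewrite mul0r; lra.
have [bae|bae] := ltP (b - a) e.
  move: ab; rewrite le_eqVlt => /predU1P[->|ab].
    by exists [::] => //; split => //=; rewrite eqxx.
  exists [:: b]; first exact: itv_partition1.
  by move=> [|i]//= _.
have [||s ps ms] := IH (a + e / 2); first by lra.
  by move: hN; rewrite -natr1 mulrDl mul1r; lra.
exists (a + e / 2 :: s).
  by case: ps => ps ls; split => //=; rewrite ps andbT; lra.
move=> [|i]/= si; first by rewrite /part_pt/=; lra.
by rewrite !part_ptS// ?ms// ltnW.
Qed.

Lemma near_mesh a b (P : seq R -> Prop) :
  (exists2 e, 0 < e & forall s, itv_partition a b s -> mesh_lt a s e -> P s) ->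
  mesh_filter a b P.
Proof. by case=> e e0 h; exists e => // s [ps ms]; exact: h. Qed.

Lemma mesh_near a b (P : seq R -> Prop) : mesh_filter a b P ->
  exists2 e, 0 < e & forall s, itv_partition a b s -> mesh_lt a s e -> P s.
Proof. by case=> e e0 h; exists e => // s ps ms; apply: h. Qed.

#[global] Instance mesh_filter_filter a b : Filter (mesh_filter a b).
Proof.
apply: filter_from_filter; first by exists 1 => /=.
move=> e e' /= e0 e0'; exists (Num.min e e'); first by rewrite /= lt_min e0.
move=> s [ps ms]; split; split => // i si; have := ms _ si.
  by rewrite lt_min => /andP[].
by rewrite lt_min => /andP[].
Qed.

Lemma mesh_filter_proper a b : a <= b -> ProperFilter (mesh_filter a b).
Proof.
move=> ab; split; last exact: mesh_filter_filter.
move=> /mesh_near[e e0 h]; have [s ps ms] := mesh_partition_exists ab e0.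
exact: h ps ms.
Qed.

Lemma mesh_cvg (V : normedModType R) (F : seq R -> V) a b (w : V) :
  (forall eps, 0 < eps -> exists2 e, 0 < e &
     forall s, itv_partition a b s -> mesh_lt a s e -> `|w - F s| <= eps) ->
  F @ mesh_filter a b --> w.
Proof.
by move=> h; apply/cvgrPdist_le => eps /h[e e0 he]; apply: near_mesh; exists e.
Qed.

Lemma mesh_cvg_cst (V : normedModType R) (F : seq R -> V) a b (w : V) :
  (forall s, itv_partition a b s -> F s = w) -> F @ mesh_filter a b --> w.
Proof.
move=> h; apply: mesh_cvg => eps eps0; exists 1 => // s ps _.
by rewrite h// subrr normr0 ltW.
Qed.

Lemma partition_telescope (V : zmodType) (K : R -> V) a b s :
  itv_partition a b s ->
  \sum_(0 <= i < size s) (K (part_pt a s i.+1) - K (part_pt a s i))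
  = K b - K a.
Proof.
move=> ps; rewrite (telescope_sumr (fun i => K (part_pt a s i)))//.
by rewrite (part_pt_last ps).
Qed.

(** Local errors proportional to [v - u] add up to one proportional to [b - a], because the lengths
    telescope just as the increments of [K] do. *)
Lemma partition_sum_le (K : R -> R) (f : R -> R -> R) a b s eps e :
  itv_partition a b s -> mesh_lt a s e ->
  (forall u v, a <= u -> u < v -> v <= b -> v - u < e ->
     `|K v - K u - f u v| <= eps * (v - u)) ->
  `|K b - K a - \sum_(0 <= i < size s) f (part_pt a s i) (part_pt a s i.+1)|
    <= eps * (b - a).
Proof.
move=> ps ms h; rewrite -(partition_telescope K ps).
rewrite -(partition_telescope id ps) -sumrB mulr_sumr.
apply: (le_trans (ler_norm_sum _ _ _)).
rewrite !big_nat; apply: ler_sum => i /= si.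
have /andP[? _] := part_pt_itv ps (ltnW si).
have /andP[_ ?] := part_pt_itv ps si.
by apply: h => //; [exact: part_pt_lt ps _|exact: ms].
Qed.

(** An error quadratic in [v - u] is at most [C * e * (v - u)] on intervals shorter than [e], so the
    total error is of order [e]. Integrals with Lipschitz data are computed in this way from an
    explicit primitive [K]. *)
Lemma young_int_quadratic (K f g : R -> R) (a b C : R) : a <= b -> 0 <= C ->
  (forall u v, a <= u -> u < v -> v <= b ->
     `|K v - K u - f u * (g v - g u)| <= C * (v - u) ^+ 2) ->
  is_young_int (W := R^o) (@GRing.mul R) f g a b (K b - K a).
Proof.
move=> ab C0 h; apply: mesh_cvg => eps eps0.
have C1 : 0 < C * (b - a) + 1.
  by rewrite ltr_wpDl// mulr_ge0// subr_ge0.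
exists (eps / (C * (b - a) + 1)); first by rewrite /= divr_gt0.
move=> s ps ms; set e := eps / _ in ms.
have : `|K b - K a - young_sum (@GRing.mul R) f g a s|
    <= C * e * (b - a).
  apply: (partition_sum_le (f := fun u v => f u * (g v - g u)) ps ms).
  move=> u v au uv vb uve; apply: (le_trans (h _ _ au uv vb)).
  rewrite -mulrA ler_wpM2l// expr2 ler_wpM2r//; [lra|exact: ltW].
move=> /le_trans; apply; rewrite mulrAC /e mulrA ler_pdivrMr// mulrC.
by rewrite ler_wpM2l ?ltW//; lra.
Qed.

End Partitions.

(** * Integrals of continuous functions on subintervals of [0, 1] *)

Section Integrals.
Context {R : realType}.
Set Implicit Arguments.
Unset Strict Implicit.
Notation mu := (@lebesgue_measure R).
Implicit Types (h k : R -> R) (u v : R).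

Definition cont01 h := {within `[0, 1], continuous h}.

Definition segint h u v : R := \int[mu]_(x in `[u, v]) h x.

Lemma cont01_cvg h : (forall x, 0 <= x <= 1 -> forall eps, 0 < eps ->
  exists2 e, 0 < e & forall y, 0 <= y <= 1 -> `|x - y| < e ->
    `|h x - h y| <= eps) <-> cont01 h.
Proof.
split=> [ch|/subspace_continuousP ch x x01 eps eps0].
  apply/subspace_continuousP => x /=; rewrite in_itv/= => x01.
  apply/cvgrPdist_le => eps eps0; have [e e0 he] := ch _ x01 _ eps0.
  rewrite near_withinE; apply/nbhs_ballP; exists e => //= y xy.
  by rewrite in_itv/= => y01; exact: he.
have /ch/cvgrPdist_le/(_ _ eps0) : x \in `[0, 1] by rewrite in_itv.
rewrite near_withinE => /nbhs_ballP[e /= e0 he]; exists e => // y y01 xy.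
by apply: he => //=; rewrite in_itv.
Qed.

Lemma cont01D h k : cont01 h -> cont01 k -> cont01 (fun x => h x + k x).
Proof. by move=> ch ck x; apply: cvgD; [exact: ch|exact: ck]. Qed.

Lemma cont01B h k : cont01 h -> cont01 k -> cont01 (fun x => h x - k x).
Proof. by move=> ch ck x; apply: cvgB; [exact: ch|exact: ck]. Qed.

Lemma cont01M h k : cont01 h -> cont01 k -> cont01 (fun x => h x * k x).
Proof. by move=> ch ck x; apply: cvgM; [exact: ch|exact: ck]. Qed.

Lemma cont01_continuous h : continuous h -> cont01 h.
Proof. exact: continuous_subspaceT. Qed.

Lemma cont01_cst (c : R) : cont01 (fun=> c).
Proof. by apply: cont01_continuous; exact: cst_continuous. Qed.

Lemma cont01Zl (c : R) h : cont01 h -> cont01 (fun x => c * h x).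
Proof. by apply: cont01M; exact: cont01_cst. Qed.

Lemma cont01_integrable h u v : cont01 h -> 0 <= u -> v <= 1 ->
  mu.-integrable `[u, v] (EFin \o h).
Proof.
move=> ch u0 v1; apply: continuous_compact_integrable.
  exact: segment_compact.
apply: continuous_subspaceW ch => x /=; rewrite !in_itv/=; lra.
Qed.

Lemma segintD h k u v : cont01 h -> cont01 k -> 0 <= u -> v <= 1 ->
  segint (fun x => h x + k x) u v = segint h u v + segint k u v.
Proof. by move=> *; apply: RintegralD => //; exact: cont01_integrable. Qed.

Lemma segintB h k u v : cont01 h -> cont01 k -> 0 <= u -> v <= 1 ->
  segint (fun x => h x - k x) u v = segint h u v - segint k u v.
Proof. by move=> *; apply: RintegralB => //; exact: cont01_integrable. Qed.

Lemma segintZl (c : R) h u v : cont01 h -> 0 <= u -> v <= 1 ->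
  segint (fun x => c * h x) u v = c * segint h u v.
Proof. by move=> *; apply: RintegralZl => //; exact: cont01_integrable. Qed.

Lemma eq_segint h k u v : (forall x, u <= x <= v -> h x = k x) ->
  segint h u v = segint k u v.
Proof.
move=> hk; apply: eq_Rintegral => x; rewrite inE/= in_itv/=; exact: hk.
Qed.

Lemma segint_cst (c u v : R) : u <= v -> segint (fun=> c) u v = c * (v - u).
Proof.
move=> uv; rewrite /segint Rintegral_cst//.
have muE : mu `[u, v] = (v - u)%:E.
  rewrite lebesgue_measure_itv/= lte_fin; case: ltP => vu; first by rewrite EFinB.
  by congr EFin; lra.
exact: (congr1 (fun z => c * fine z) muE).
Qed.

Lemma le_segint h k u v : cont01 h -> cont01 k -> 0 <= u -> v <= 1 ->
  (forall x, u <= x <= v -> h x <= k x) -> segint h u v <= segint k u v.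
Proof.
move=> ch ck u0 v1 hk; apply: le_Rintegral; [by []|exact: cont01_integrable..|].
by move=> x /=; rewrite in_itv/=; exact: hk.
Qed.

Lemma segint_cat h u v w : cont01 h -> 0 <= u -> u <= v -> v <= w -> w <= 1 ->
  segint h u w = segint h u v + segint h v w.
Proof.
move=> ch u0 uv vw w1.
rewrite /segint -(@Rintegral_itv_obnd_cbnd _ v).
  rewrite -(@Rintegral_itvB _ h (BLeft u) (BRight w) v) ?bnd_simp//.
    by rewrite addrC subrK.
  exact: cont01_integrable.
apply: (@integrableS _ _ _ mu `[v, w]) => //.
  by move=> x /=; rewrite !in_itv/=; lra.
by apply: cont01_integrable => //; lra.
Qed.

Lemma segintxx h u : segint h u u = 0.
Proof. by rewrite /segint set_itv1 Rintegral_set1. Qed.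

Lemma segint_dist h u v (c e : R) : cont01 h -> 0 <= u -> u <= v -> v <= 1 ->
  (forall x, u <= x <= v -> `|h x - c| <= e) ->
  `|segint h u v - c * (v - u)| <= e * (v - u).
Proof.
move=> ch u0 uv v1 hc.
have cc (c' : R) : cont01 (fun=> c') by exact: cont01_cst.
have : segint h u v <= segint (fun=> c + e) u v.
  by apply: le_segint => // x /hc; rewrite ler_distl; lra.
have : segint (fun=> c - e) u v <= segint h u v.
  by apply: le_segint => // x /hc; rewrite ler_distl; lra.
rewrite !segint_cst// ler_distl; lra.
Qed.

(** This is [partition_sum_le] for the primitive [segint h 0]. The modulus [e] is a hypothesis, not
    extracted from continuity, so that a whole family of sections can share it. *)
Lemma segint_Riemann_sum h t s (eps e : R) : cont01 h -> 0 <= t <= 1 ->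
  itv_partition 0 t s -> mesh_lt 0 s e ->
  (forall u v, 0 <= u <= 1 -> 0 <= v <= 1 -> `|u - v| < e ->
    `|h u - h v| <= eps) ->
  `|segint h 0 t - \sum_(0 <= i < size s)
      (part_pt 0 s i.+1 - part_pt 0 s i) * h (part_pt 0 s i)| <= eps * t.
Proof.
move=> ch t01 ps ms hh.
have := @partition_sum_le R (segint h 0) (fun u v => (v - u) * h u) 0 t s
  eps e ps ms.
rewrite segintxx !subr0; apply => u v u0 uv vt vue.
rewrite (@segint_cat h 0 u v)//; try lra.
rewrite [_ + segint h u v]addrC addrK [_ * h u]mulrC.
apply: segint_dist => //; try lra.
by move=> x ux; rewrite distrC; apply: hh; [lra|lra|rewrite ltr_norml; lra].
Qed.

Lemma segint_gt0 h t : cont01 h -> (forall x, 0 <= x <= 1 -> 0 <= h x) ->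
  0 <= t <= 1 -> 0 < h t -> 0 < segint h 0 1.
Proof.
move=> ch h0 t01 ht.
have [e e0 he] := (cont01_cvg h).2 ch _ t01 _ (divr_gt0 ht (ltr0n _ 2)).
(* Clipping leaves a nondegenerate interval even when [t] is an endpoint; the half radius keeps it
   strictly within distance [e] of [t], where [h] is at least [h t / 2]. *)
pose u := Num.max 0 (t - e / 2); pose v := Num.min 1 (t + e / 2).
have [uv u0 v1] : [/\ u < v, 0 <= u & v <= 1].
  rewrite /u /v; case: (leP 0 (t - e / 2)); case: (leP 1 (t + e / 2));
    by split; lra.
have uvt : t - e / 2 <= u /\ v <= t + e / 2.
  rewrite /u /v; case: (leP 0 (t - e / 2)); case: (leP 1 (t + e / 2));
    by split; lra.
have h_uv : 0 < segint h u v.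
  apply: (@lt_le_trans _ _ (segint (fun=> h t / 2) u v)).
    by rewrite segint_cst ?ltW// mulr_gt0//; lra.
  apply: le_segint => //; first exact: cont01_cst.
  move=> x ux; 
  have : `|h t - h x| <= h t / 2 by apply: he; [lra|rewrite ltr_norml; lra].
  by rewrite ler_norml; lra.
have ge0 a b : 0 <= a -> a <= b -> b <= 1 -> 0 <= segint h a b.
  move=> a0 ab b1; have <- : segint (fun=> 0) a b = 0.
    by rewrite segint_cst// mul0r.
  by apply: le_segint => //; [exact: cont01_cst|move=> x ax; apply: h0; lra].
rewrite (@segint_cat h 0 u 1)//; try lra.
rewrite (@segint_cat h u v 1)//; try lra.
have := ge0 0 u; have := ge0 v 1; lra.
Qed.

End Integrals.

(** * Injectivity of the Laplace transform at natural exponents *)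

Section LaplaceTransform.
Context {R : realType}.
Set Implicit Arguments.
Unset Strict Implicit.
Implicit Types (h g : R -> R) (u v x y t : R).

(** Convexity: the graph lies above its tangent at [u]. As [u] and [v] come in either order,
    exchanging them bounds the increment from above. *)
Lemma expR_diff_ge u v : expR u * (v - u) <= expR v - expR u.
Proof.
have := expR_ge1Dx (v - u).
by rewrite expRB ler_pdivlMr ?expR_gt0//; lra.
Qed.

(** The slope of [expR] is at least 1 on the nonnegative half-line, so points at distance [e] remain
    at least that far apart in the variable [expR x]. *)
Lemma expR_dist_ge x y : 0 <= x -> 0 <= y -> `|x - y| <= `|expR x - expR y|.
Proof.
wlog xy : x y / x <= y.
  move=> wl x0 y0; have [xy|/ltW yx] := leP x y; first exact: wl.
  by rewrite distrC [leRHS]distrC; exact: wl.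
move=> x0 y0; rewrite distrC ger0_norm ?subr_ge0//.
rewrite distrC; apply: le_trans (ler_norm _).
have := expR_diff_ge x y; have := expR_ge1Dx x; nra.
Qed.

Lemma Bernoulli_ineq q k : 0 <= q -> 1 + k%:R * (q - 1) <= q ^+ k :> R.
Proof.
move=> q0; elim: k => [|k IH]; first by rewrite mul0r expr0 addr0.
(* [q (1 + k (q - 1))] exceeds [1 + (k + 1) (q - 1)] by [k (q - 1) ^ 2]. *)
rewrite exprS -natr1; have := sqr_ge0 (q - 1); have : (0:R) <= k%:R by [].
nra.
Qed.

Lemma cont01_expR : cont01 (@expR R).
Proof. by apply: cont01_continuous; exact: continuous_expR. Qed.

Lemma cont01X g k : cont01 g -> cont01 (fun x => g x ^+ k).
Proof.
move=> cg; elim: k => [|k IH]; first exact: cont01_cst.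
by under eq_fun do rewrite exprS; exact: cont01M.
Qed.

Definition annihilates_exp g := forall a : nat,
  segint (fun x => expR x ^+ a * g x) 0 1 = 0.

(** A polynomial factor in [expR x] only shifts the exponents. Degree two is that of the peak
    function to which this is applied; its powers are reached by iteration. *)
Lemma annihilates_expM g (c0 c1 c2 : R) : cont01 g -> annihilates_exp g ->
  annihilates_exp (fun x => (c0 + c1 * expR x + c2 * expR x ^+ 2) * g x).
Proof.
move=> cg ann a.
have ce b : cont01 (fun x => expR x ^+ b * g x).
  by apply: cont01M => //; apply: cont01X; exact: cont01_expR.
rewrite (@eq_segint _ _ (fun x => c0 * (expR x ^+ a * g x) +
  (c1 * (expR x ^+ a.+1 * g x) + c2 * (expR x ^+ a.+2 * g x)))); last first.
  by move=> x _; rewrite !exprS; ring.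
rewrite !segintD ?segintZl ?ann ?mulr0 ?addr0//;
  by do ?apply: cont01D; exact: cont01Zl.
Qed.

(* If h t > 0, the exponential polynomial q is at most 1 away from t and exceeds
   1 near t, so the integral of q ^+ k * h would be unbounded in k. *)
Lemma annihilates_exp_le0 h : cont01 h -> annihilates_exp h ->
  forall t, 0 <= t <= 1 -> h t <= 0.
Proof.
move=> ch ann t t01; rewrite leNgt; apply/negP => ht.
have [e e0 he] := (cont01_cvg h).2 ch _ t01 _ (divr_gt0 ht (ltr0n _ 2)).
(* Two values of [expR] on [0, 1] differ by at most [expR 1], so this factor brings
   [k0 * (expR x - expR t) ^+ 2] down to at most 1 and keeps [q] nonnegative. *)
pose k0 : R := (expR 1 ^+ 2)^-1.
have k0_gt0 : 0 < k0 by rewrite invr_gt0 exprn_gt0// expR_gt0.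
(* The offset [k0 * e ^+ 2] is the height lost once [expR x] is at distance [e] from [expR t], which
   happens at the latest when [x] is at distance [e] from [t]. *)
pose q x := 1 + k0 * e ^+ 2 - k0 * (expR x - expR t) ^+ 2.
have cq : cont01 q.
  apply: cont01_continuous => x; apply: cvgB; first exact: cvg_cst.
  apply: cvgM; first exact: cvg_cst.
  under eq_fun do rewrite expr2.
  have cEt : (expR y - expR t) @[y --> x] --> expR x - expR t.
    by apply: cvgB; [exact: continuous_expR|exact: cvg_cst].
  by rewrite expr2; exact: cvgM.
have q_ge0 x : 0 <= x <= 1 -> 0 <= q x.
  move=> x01; have : k0 * (expR x - expR t) ^+ 2 <= 1.
    rewrite /k0 mulrC ler_pdivrMr ?exprn_gt0 ?expR_gt0// mul1r.
    have E y : 0 <= y <= 1 -> 0 < expR y <= expR 1.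
      by move=> y01; rewrite expR_gt0 ler_expR; case/andP: y01.
    by have := E _ x01; have := E _ t01; nra.
  by have := mulr_gt0 k0_gt0 (exprn_gt0 2 e0); rewrite /q; lra.
have q_le1 x : 0 <= x <= 1 -> e <= `|t - x| -> q x <= 1.
  move=> x01 ex; have : e ^+ 2 <= (expR x - expR t) ^+ 2.
    rewrite -[leRHS]real_normK ?num_real// ler_sqr ?nnegrE ?(ltW e0)//.
    by apply: le_trans ex _; rewrite distrC; apply: expR_dist_ge; lra.
  by rewrite /q => /(ler_wpM2l (ltW k0_gt0)); lra.
have ann_q k : cont01 (fun x => q x ^+ k * h x) /\
    annihilates_exp (fun x => q x ^+ k * h x).
  elim: k => [|k [cqk IH]].
    by under eq_fun do rewrite expr0 mul1r; split.
  split; first by apply: cont01M => //; exact: cont01X.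
  have := annihilates_expM (1 + k0 * e ^+ 2 - k0 * expR t ^+ 2)
    (k0 * (2 * expR t)) (- k0) cqk IH.
  congr annihilates_exp; apply/funext => x.
  rewrite [q x ^+ k.+1]exprS -[RHS]mulrA.
  by apply: (congr1 (fun z => z * (q x ^+ k * h x))); rewrite /q; ring.
have [m m01 hm] := EVT_min ler01 ch.
pose M := `|h m|.
have hM x : 0 <= x <= 1 -> - M <= h x.
  move=> x01; apply: (@le_trans _ _ (h m)); last by apply: hm; rewrite in_itv.
  by have := ler_norm (- h m); rewrite normrN -/M; lra.
pose psi x := Num.max 0 (q x - 1).
have cpsi : cont01 psi.
  apply/cont01_cvg => x x01 eps eps0.
  have [d d0 hd] := (cont01_cvg q).2 cq _ x01 _ eps0.
  exists d => // y y01 /hd -/(_ y01); rewrite /psi !ler_norml.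
  by case: (leP 0 (q x - 1)); case: (leP 0 (q y - 1)); lra.
have S_gt0 : 0 < segint psi 0 1.
  apply: (@segint_gt0 _ psi t) => //.
    by move=> x _; rewrite /psi le_max lexx.
  rewrite /psi lt_max; apply/orP; right.
  by have := mulr_gt0 k0_gt0 (exprn_gt0 2 e0); rewrite /q subrr expr0n/=; lra.
(* Pointwise, [q ^+ k * h] is at least [k%:R * (h t / 2) * psi - M]: where [q > 1], Bernoulli's
   inequality applies and [h] is at least [h t / 2]; elsewhere [q ^+ k] lies in [0, 1]. The integral
   of [q ^+ k * h] is 0. *)
have bound k : k%:R * (h t / 2) * segint psi 0 1 <= M.
  have [cqk /(_ 0%N) aqk] := ann_q k.
  have : segint (fun x => (k%:R * (h t / 2)) * psi x + - M) 0 1 <=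
         segint (fun x => q x ^+ k * h x) 0 1.
    apply: le_segint => //.
      by apply: cont01D; [exact: cont01Zl|exact: cont01_cst].
    move=> x x01; have hMx := hM _ x01; have qx0 := q_ge0 _ x01.
    have M0 : 0 <= M by exact: normr_ge0.
    have Bx := Bernoulli_ineq k qx0.
    rewrite /psi; case: (ltP 0 (q x - 1)) => qx1.
      have hx : h t / 2 <= h x.
        have : `|h t - h x| <= h t / 2.
          by apply: he => //; rewrite ltNge; apply/negP => /(q_le1 _ x01); lra.
        by rewrite ler_norml; lra.
      have k_ge0 : (0 : R) <= k%:R by [].
      have : k%:R * (q x - 1) * (h t / 2) <= q x ^+ k * h x.
        by apply: ler_pM; nra.
      nra.
    have : q x ^+ k <= 1 by apply: exprn_ile1 => //; lra.
    have : 0 <= q x ^+ k by exact: exprn_ge0.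
    nra.
  rewrite segintD//; [|exact: cont01Zl|exact: cont01_cst].
  rewrite segintZl// segint_cst//.
  move: aqk; under [X in segint X]eq_fun do rewrite expr0 mul1r.
  by move=> ->; lra.
have pos : 0 < h t / 2 * segint psi 0 1 by rewrite mulr_gt0//; lra.
have := bound (Num.truncn (M / (h t / 2 * segint psi 0 1))).+1.
by rewrite -mulrA leNgt -ltr_pdivrMr// truncnS_gt.
Qed.

Lemma annihilates_exp_eq0 h : cont01 h -> annihilates_exp h ->
  forall t, 0 <= t <= 1 -> h t = 0.
Proof.
move=> ch ann t t01; apply/eqP; rewrite eq_le annihilates_exp_le0//=.
rewrite -oppr_le0; apply: (@annihilates_exp_le0 (fun x => - h x)) => //.
  by move=> x; apply: cvgN; exact: ch.
move=> a; rewrite (@eq_segint _ _ (fun x => -1 * (expR x ^+ a * h x))).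
  rewrite segintZl ?ann ?mulr0//; apply: cont01M => //.
  by apply: cont01X; exact: cont01_expR.
by move=> x _; rewrite mulN1r mulrN.
Qed.

End LaplaceTransform.

(** * Double integrals and their Riemann sums *)

Section DoubleIntegrals.
Context {R : realType}.
Set Implicit Arguments.
Unset Strict Implicit.
Implicit Types (f g : R -> R -> R).

(** Uniformity lets one [e] serve every section in either variable, as Riemann sums over a product
    of partitions require. *)
Definition ucont2 f := forall eps, 0 < eps -> exists2 e, 0 < e &
  forall s s' t t', 0 <= s <= 1 -> 0 <= s' <= 1 -> 0 <= t <= 1 ->
    0 <= t' <= 1 -> `|s - s'| < e -> `|t - t'| < e -> `|f s t - f s' t'| <= eps.

Definition bounded2 f (M : R) :=
  forall s t, 0 <= s <= 1 -> 0 <= t <= 1 -> `|f s t| <= M.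

Lemma ucont2M f g M N : bounded2 f M -> bounded2 g N -> ucont2 f -> ucont2 g ->
  ucont2 (fun s t => f s t * g s t).
Proof.
move=> bf bg cf cg eps eps0.
have M0 : 0 <= M by rewrite (le_trans _ (bf 0 0 _ _))// ?lexx ler01.
have N0 : 0 <= N by rewrite (le_trans _ (bg 0 0 _ _))// ?lexx ler01.
have d0 : 0 < eps / (M + N + 1) by rewrite divr_gt0//; lra.
have [e e0 he] := cf _ d0; have [e' e'0 he'] := cg _ d0.
exists (Num.min e e'); first by rewrite lt_min e0.
move=> s s' t t' s01 s'01 t01 t'01; rewrite !lt_min.
move=> /andP[se se'] /andP[te te'].
have -> : f s t * g s t - f s' t' * g s' t' =
    (f s t - f s' t') * g s t + f s' t' * (g s t - g s' t') by ring.
apply: (le_trans (ler_normD _ _)); rewrite !normrM.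
apply: (@le_trans _ _ (eps / (M + N + 1) * N + M * (eps / (M + N + 1)))).
  by apply: lerD; apply: ler_pM => //; [exact: he|exact: bg|exact: bf|exact: he'].
rewrite [M * _]mulrC -mulrDr mulrAC ler_pdivrMr; last by lra.
by rewrite ler_pM2l//; lra.
Qed.

Lemma ucont2_section f t : ucont2 f -> 0 <= t <= 1 -> cont01 (f ^~ t).
Proof.
move=> cf t01; apply/cont01_cvg => s s01 eps /cf[e e0 he].
by exists e => // s' s'01 ss'; apply: he => //; rewrite subrr normr0.
Qed.

Lemma segint_section_dist f t t' (eps e : R) : ucont2 f -> 0 <= t <= 1 ->
  0 <= t' <= 1 -> (forall s, 0 <= s <= 1 -> `|f s t - f s t'| <= eps) ->
  `|segint (f ^~ t) 0 1 - segint (f ^~ t') 0 1| <= eps.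
Proof.
move=> cf t01 t'01 h.
have ct := ucont2_section cf t01; have ct' := ucont2_section cf t'01.
rewrite -segintB//.
have := @segint_dist _ (fun s => f s t - f s t') 0 1 0 eps.
rewrite mul0r !subr0 mulr1; apply => //; first exact: cont01B.
by move=> s s01; rewrite subr0; exact: h.
Qed.

Lemma cont01_segint f : ucont2 f -> cont01 (fun t => segint (f ^~ t) 0 1).
Proof.
move=> cf; apply/cont01_cvg => t t01 eps /cf[e e0 he].
exists e => // t' t'01 tt'; apply: segint_section_dist => // s s01.
by apply: he => //; rewrite subrr normr0.
Qed.

(** The outer variable carries the bound [t] because the surface development runs along [t] with the
    first coordinate at 1. *)
Definition segint2 f t := segint (fun t' => segint (f ^~ t') 0 1) 0 t.

Lemma segint2_Riemann_sum f t : ucont2 f -> 0 <= t <= 1 ->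
  forall eps, 0 < eps -> exists2 e, 0 < e & forall P Q,
    itv_partition 0 1 P -> mesh_lt 0 P e ->
    itv_partition 0 t Q -> mesh_lt 0 Q e ->
    `|segint2 f t - \sum_(0 <= i < size P) \sum_(0 <= j < size Q)
       (part_pt 0 P i.+1 - part_pt 0 P i) * (part_pt 0 Q j.+1 - part_pt 0 Q j)
       * f (part_pt 0 P i) (part_pt 0 Q j)| <= eps.
Proof.
move=> cf t01 eps eps0; have eps2 : 0 < eps / 2 by lra.
have [e e0 he] := cf _ eps2; exists e => // P Q pP mP pQ mQ.
pose k t' := segint (f ^~ t') 0 1.
(* Intermediate between the integral and the double sum: exact inner integrals, sampled in the outer
   variable. Each side costs [eps / 2]. *)
pose S := \sum_(0 <= j < size Q)
  (part_pt 0 Q j.+1 - part_pt 0 Q j) * k (part_pt 0 Q j).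
have dS : `|segint2 f t - S| <= eps / 2 * t.
  apply: segint_Riemann_sum pQ mQ _ => //; first exact: cont01_segint.
  move=> u v u01 v01 uv; apply: segint_section_dist => // s s01.
  by apply: he => //; rewrite subrr normr0.
have dS' : `|S - \sum_(0 <= i < size P) \sum_(0 <= j < size Q)
       (part_pt 0 P i.+1 - part_pt 0 P i) * (part_pt 0 Q j.+1 - part_pt 0 Q j)
       * f (part_pt 0 P i) (part_pt 0 Q j)| <= eps / 2 * t.
  rewrite exchange_big/= -sumrB.
  rewrite -[t in leRHS]subr0 -(partition_telescope id pQ) mulr_sumr.
  apply: (le_trans (ler_norm_sum _ _ _)).
  rewrite !big_nat; apply: ler_sum => j /= jQ.
  have q01 : 0 <= part_pt 0 Q j <= 1.
    by have := part_pt_itv pQ (ltnW jQ); lra.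
  have dq := part_pt_lt pQ jQ.
  rewrite (eq_bigr (fun i => (part_pt 0 Q j.+1 - part_pt 0 Q j) *
    ((part_pt 0 P i.+1 - part_pt 0 P i) * f (part_pt 0 P i) (part_pt 0 Q j))));
    last by move=> i _; rewrite mulrA [X in X * _]mulrC.
  rewrite -mulr_sumr -mulrBr normrM gtr0_norm ?subr_gt0// mulrC.
  rewrite ler_pM2r ?subr_gt0// -[leRHS]mulr1.
  apply: segint_Riemann_sum pP mP _ => //; first exact: ucont2_section.
    by rewrite ler01 lexx.
  by move=> u v u01 v01 uv; apply: he => //; rewrite subrr normr0.
have := ler_distD S (segint2 f t) (\sum_(0 <= i < size P)
  \sum_(0 <= j < size Q) (part_pt 0 P i.+1 - part_pt 0 P i) *
  (part_pt 0 Q j.+1 - part_pt 0 Q j) * f (part_pt 0 P i) (part_pt 0 Q j)).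
by nra.
Qed.

End DoubleIntegrals.

(** * Uniqueness for linear Young equations and scalar developments *)

Section PathDevelopments.
Context {R : realType}.
Set Implicit Arguments.
Unset Strict Implicit.

Lemma mx_entry_le m n (M : 'M[R]_(m, n)) i j : `|M i j| <= `|M|.
Proof.
rewrite [leRHS]mx_normrE.
exact: (le_bigmax _ (fun ij => `|M ij.1 ij.2|) (i, j)).
Qed.

Lemma cvg_mx_entry (T : Type) (F : set_system T) (FF : Filter F) m n
    (f : T -> 'M[R]_(m, n)) (w : 'M[R]_(m, n)) i j :
  f @ F --> w -> (fun x => f x i j) @ F --> w i j.
Proof.
exact: (continuous_cvg _ (@coord_continuous R m n i j w)).
Qed.

Lemma young_int_unique (U : Type) (V : zmodType) (W : normedModType R)
    (op : U -> V -> W) f g a b w w' : a <= b ->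
  is_young_int op f g a b w -> is_young_int op f g a b w' -> w = w'.
Proof.
move=> ab fw fw'; have pF := mesh_filter_proper ab.
exact: (cvg_unique _ fw fw').
Qed.

Lemma young_intE (U : Type) (V : zmodType) (W : normedModType R)
    (op : U -> V -> W) f g a b w : a <= b ->
  is_young_int op f g a b w -> young_int op f g a b = w.
Proof.
move=> ab fw; have pF := mesh_filter_proper ab.
exact: cvg_lim fw.
Qed.

Lemma young_sum_entry m n p (F : R -> 'M[R]_(m, n)) (G : R -> 'M[R]_(n, p)) a s
    i j : young_sum mulmx F G a s i j = \sum_k
    young_sum (@GRing.mul R) (fun u => F u i k) (fun u => G u k j) a s.
Proof.
rewrite /young_sum exchange_big summxE; apply: eq_bigr => l _.
by rewrite mxE; apply: eq_bigr => k _; rewrite !mxE.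
Qed.

Lemma young_int_entry m n p (F : R -> 'M[R]_(m, n)) (G : R -> 'M[R]_(n, p)) a b
    w : is_young_int mulmx F G a b w -> forall i j,
  (fun s => \sum_k
     young_sum (@GRing.mul R) (fun u => F u i k) (fun u => G u k j) a s)
    @ mesh_filter a b --> w i j.
Proof.
move=> FG i j; under eq_fun do rewrite -young_sum_entry.
exact: cvg_mx_entry FG.
Qed.

(* Gronwall: the weight [expR (2 * L * t)] halves the bound at each Picard
   iteration. *)
Lemma linear_young_eq0 (D g : R -> R) (M L : R) : 0 < L ->
  (forall u, 0 <= u <= 1 -> `|D u| <= M) ->
  (forall u v, 0 <= u -> u <= v -> v <= 1 -> `|g v - g u| <= L * (v - u)) ->
  (forall t, 0 <= t <= 1 ->
    is_young_int (W := R^o) (@GRing.mul R) D g 0 t (D t)) ->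
  forall t, 0 <= t <= 1 -> D t = 0.
Proof.
move=> L0 DM gL int t t01.
have M0 : 0 <= M by apply: le_trans (normr_ge0 _) (DM _ t01).
have step k u : 0 <= u <= 1 ->
    `|D u| <= M / 2 ^+ k * expR (2 * L * u).
  elim: k u => [|k IH] u u01.
    rewrite expr0 divr1; apply: (le_trans (DM _ u01)).
    rewrite ler_peMr//; have := expR_ge1Dx (2 * L * u); nra.
  apply/ler_addgt0Pr => eps eps0; have u0 : 0 <= u by lra.
  have /cvgrPdist_le/(_ _ eps0)/mesh_near[e e0 he] := int _ u01.
  have [s ps ms] := mesh_partition_exists u0 e0.
  have Du := he _ ps ms.
  suff : `|young_sum (@GRing.mul R) D g 0 s| <=
      M / 2 ^+ k.+1 * expR (2 * L * u).
    have := ler_normD (D u - young_sum (@GRing.mul R) D g 0 s)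
      (young_sum (@GRing.mul R) D g 0 s).
    rewrite subrK => + hs; move=> /le_trans; apply.
    by rewrite addrC lerD.
  (* By the tangent inequality [2 * L * (p' - p) * expR (2 * L * p)] is at most the increment of the
     weight, so the weighted sum telescopes; the 2 in the exponent is the factor gained per
     iteration. *)
  apply: (@le_trans _ _ (M / 2 ^+ k.+1 * (expR (2 * L * u) - expR (2 * L * 0)))).
    rewrite -(partition_telescope (fun v => expR (2 * L * v)) ps) mulr_sumr.
    apply: (le_trans (ler_norm_sum _ _ _)).
    rewrite !big_nat; apply: ler_sum => i /= si.
    have := part_pt_itv ps (ltnW si); have := part_pt_itv ps si.
    have := part_pt_lt ps si.
    move: (part_pt 0 s i) (part_pt 0 s i.+1) => p p' pp' p'u pu.
    rewrite normrM.
    apply: (@le_trans _ _ (M / 2 ^+ k * expR (2 * L * p) * (L * (p' - p)))).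
      by apply: ler_pM => //; [apply: IH; lra|apply: gL; lra].
    have -> : M / 2 ^+ k.+1 = M / 2 ^+ k / 2.
      by rewrite exprSr invfM mulrA.
    have := expR_diff_ge (2 * L * p) (2 * L * p').
    have : 0 <= M / 2 ^+ k by rewrite divr_ge0// exprn_ge0.
    move: (M / 2 ^+ k) (expR _) (expR _) => c x y c0 xy.
    rewrite -!mulrA ler_wpM2l//; lra.
  rewrite ler_wpM2l//; first by rewrite divr_ge0// exprn_ge0.
  by have := expR_gt0 (2 * L * 0); lra.
apply/eqP; rewrite -normr_eq0 eq_le normr_ge0 andbT leNgt; apply/negP => Dt.
pose B := M * expR (2 * L * t).
have bound k : k%:R * `|D t| <= B.
  apply: (@le_trans _ _ (2 ^+ k * `|D t|)).
    by rewrite ler_pM2r//; have := @Bernoulli_ineq R 2 k; lra.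
  have := step k t t01; rewrite mulrAC ler_pdivlMr ?exprn_gt0//.
  by rewrite mulrC.
have := bound (Num.truncn (B / `|D t|)).+1.
by rewrite leNgt -ltr_pdivrMr// truncnS_gt.
Qed.

(** [xget] selects among end values, so competing solutions have to agree at time 1 only. *)
Lemma path_dev_eq D k rho (alpha : 'I_D -> 'M[R]_k) x F :
  solves_path_dev rho alpha x F ->
  (forall F', solves_path_dev rho alpha x F' -> F' 1 = F 1) ->
  path_dev rho alpha x = F 1.
Proof.
move=> sF uF; apply: xget_unique; first by exists F.
by move=> _ [F' sF' <-]; exact: uF.
Qed.

(** Turns Lipschitz bounds into Hölder bounds for increments of length at most 1. *)
Lemma powR_ge_id (u rho : R) : 0 <= u <= 1 -> rho <= 1 -> u <= u `^ rho.
Proof.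
move=> /andP[]; rewrite le_eqVlt => /predU1P[<- _ _|u0 u1 r1].
  exact: powR_ge0.
by apply: ger1_powR => //; rewrite u0.
Qed.

(** In dimension one the solution is [expR (g u)], bounded by its end value since [g] is
    nondecreasing. For uniqueness, the entry of another solution minus this one solves the
    homogeneous equation of [linear_young_eq0]. *)
Lemma path_dev_scalar D (rho L : R) (alpha : 'I_D -> 'M[R]_1) x g :
  0 <= rho <= 1 -> 0 < L -> g 0 = 0 ->
  (forall u, apply_form alpha (x u) = (g u)%:M) ->
  (forall u v, 0 <= u -> u <= v -> v <= 1 -> 0 <= g v - g u <= L * (v - u)) ->
  path_dev rho alpha x = (expR (g 1))%:M.
Proof.
move=> rho01 L0 g0 xg gL.
have {}xg : (fun u => apply_form alpha (x u)) = (fun u => (g u)%:M).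
  exact/funext.
pose E u := expR (g u).
have EL u v : 0 <= u -> u <= v -> v <= 1 ->
    0 <= E v - E u <= E 1 * (g v - g u).
  move=> u0 uv v1; have := gL _ _ u0 uv v1; have := gL v 1 (le_trans u0 uv) v1.
  move=> /(_ (lexx _)) g1 guv.
  have : E v <= E 1 by rewrite /E ler_expR; lra.
  have := expR_diff_ge (g v) (g u); have := expR_diff_ge (g u) (g v).
  have := expR_gt0 (g v); have := expR_gt0 (g u); rewrite -/(E u) -/(E v).
  by nra.
have E_int t : 0 <= t <= 1 ->
    is_young_int (W := R^o) (@GRing.mul R) E g 0 t (E t - 1).
  move=> t01; have <- : E 0 = 1 by rewrite /E g0 expR0.
  have E1 : 0 <= E 1 by exact: expR_ge0.
  apply: (@young_int_quadratic _ _ _ _ _ _ (E 1 * L ^+ 2)); first by lra.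
    by rewrite mulr_ge0// exprn_ge0// ltW.
  move=> u v u0 uv vt.
  have guv : 0 <= g v - g u <= L * (v - u) by apply: gL; lra.
  have Euv : 0 <= E v - E u <= E 1 * (g v - g u) by apply: EL; lra.
  have := expR_diff_ge (g v) (g u); have := expR_diff_ge (g u) (g v).
  rewrite -/(E u) -/(E v) => h1 h2.
  (* The tangents at both ends place the error between 0 and [(E v - E u) * (g v - g u)], whence the
     constant [E 1 * L ^+ 2]. *)
  have h3 : (E v - E u) * (g v - g u) <= E 1 * (g v - g u) ^+ 2.
    by rewrite expr2 mulrA ler_wpM2r//; lra.
  have h4 : (g v - g u) ^+ 2 <= (L * (v - u)) ^+ 2 by nra.
  have := ler_wpM2l E1 h4; rewrite exprMn mulrA ler_norml; nra.
apply: (@path_dev_eq _ _ _ _ _ (fun u => (E u)%:M)).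
  split; last 2 first.
  - by rewrite /E g0 expR0.
  - move=> t; rewrite in_itv/= xg => t01.
    apply/cvg_ballP => eps eps0.
    have /cvg_ballP/(_ _ eps0) := E_int _ t01.
    apply: filterS => s Es; split => // i j; rewrite !ord1 young_sum_entry.
    rewrite big_ord1 !mxE eqxx !mulr1n.
    under [X in young_sum _ X]eq_fun do rewrite mxE eqxx mulr1n.
    by under [X in young_sum _ _ X]eq_fun do rewrite mxE eqxx mulr1n.
  - exists (E 1 * L * `|1%:M : 'M[R]_1|) => u v; rewrite !in_itv/=.
    wlog uv : u v / u <= v.
      move=> wl u01 v01; have [uv|/ltW vu] := leP u v; first exact: wl.
      by rewrite distrC [`|u - v|]distrC; exact: wl.
    move=> u01 v01; rewrite distrC [`|u - v|]distrC.
    rewrite -raddfB/= -[(E v - E u)%:M]scalemx1 normrZ [leRHS]mulrAC ler_wpM2r//.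
    have guv : 0 <= g v - g u <= L * (v - u) by apply: gL; lra.
    have Euv : 0 <= E v - E u <= E 1 * (g v - g u) by apply: EL; lra.
    rewrite ger0_norm; last by lra.
    have E1 : 0 < E 1 by exact: expR_gt0.
    have vu1 : 0 <= v - u <= 1 by lra.
    apply: (@le_trans _ _ (E 1 * L * (v - u))).
      by have := ler_wpM2l (ltW E1) (proj2 (andP guv)); lra.
    rewrite [in leRHS]ger0_norm; last by lra.
    apply: ler_wpM2l; first by rewrite mulr_ge0 ?ltW.
    by apply: powR_ge_id => //; lra.
move=> F' [[M F'M] F'0 F'int].
pose D' u := F' u 0 0 - E u.
suff D'0 : D' 1 = 0.
  apply/matrixP => i j; rewrite !ord1 mxE eqxx mulr1n.
  by move: D'0; rewrite /D'; lra.
have M0 : 0 <= M.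
  have := F'M 0 1; rewrite !in_itv/= !lexx !ler01 => /(_ isT isT).
  by rewrite sub0r normrN normr1 powR1 mulr1; apply: le_trans.
apply: (@linear_young_eq0 D' g (M + E 1) L) => //.
- move=> u u01.
  have E0u : 0 <= E u - E 0 <= E 1 * (g u - g 0) by apply: EL; lra.
  have Eu1 : 0 <= E 1 - E u <= E 1 * (g 1 - g u) by apply: EL; lra.
  have E0 : E 0 = 1 by rewrite /E g0 expR0.
  have : `|F' u 0 0 - F' 0 0 0| <= M.
    have -> : F' u 0 0 - F' 0 0 0 = (F' u - F' 0) 0 0 by rewrite !mxE.
    apply: (le_trans (mx_entry_le _ _ _)).
    apply: (@le_trans _ _ (M * `|u - 0| `^ rho)).
      by apply: F'M; rewrite in_itv/=; lra.
    rewrite ler_piMr// subr0 ger0_norm; last by lra.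
    have -> : (1 : R) = 1 `^ rho by rewrite powR1.
    by apply: ge0_ler_powR; rewrite ?nnegrE; lra.
  rewrite F'0 mxE eqxx mulr1n /D' !ler_norml; lra.
- by move=> u v u0 uv v1; have := gL _ _ u0 uv v1; rewrite ler_norml; lra.
- move=> t t01.
  have /F'int : t \in `[0, 1] by rewrite in_itv.
  rewrite xg => /young_int_entry int; have {}int := int 0 0.
  have {int} := cvgB int (E_int _ t01).
  rewrite (_ : _ - _ = D' t); last by rewrite /D' !mxE eqxx mulr1n; lra.
  move=> h; rewrite /is_young_int.
  rewrite (_ : young_sum _ D' g 0 = (fun s => \sum_k
      young_sum (@GRing.mul R) (fun u => F' u 0 k)
        (fun u => ((g u)%:M : 'M[R]_1) k 0) 0 s
      - young_sum (W := R^o) (@GRing.mul R) E g 0 s)); first exact: h.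
  apply/funext => s; rewrite /= big_ord1 /young_sum -sumrB.
  by apply: eq_bigr => i _; rewrite !mxE !eqxx !mulr1n -mulrBl.
- by rewrite ler01 lexx.
Qed.

End PathDevelopments.

(** * Developments along a nilpotent direction of order two *)

Section NilpotentDevelopment.
Context {R : realType}.
Set Implicit Arguments.
Unset Strict Implicit.

Let N : 'M[R]_2 := delta_mx 0 1.

Let NN : N *m N = 0.
Proof. by rewrite /N mul_delta_mx_0. Qed.

Lemma invmx_1Ddelta (c : R) :
  invmx (1%:M + c *: (delta_mx 0 1 : 'M[R]_2)) = 1%:M - c *: delta_mx 0 1.
Proof.
rewrite -/N; have AB : (1%:M + c *: N) *m (1%:M - c *: N) = 1%:M.
  rewrite mulmxBr mulmx1 mulmxDl mul1mx -scalemxAr -scalemxAl NN !scaler0 addr0.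
  by rewrite addrK.
have [uA _] := mulmx1_unit AB.
by rewrite -[RHS](mulKmx uA) AB mulmx1.
Qed.

(** Since [N] squares to zero, the sums for [1 + g N] reduce to increments of [g N]. For uniqueness,
    [F' N] has zero first column, so the first column of a solution stays that of the identity; the
    second one is then driven by known increments, which telescope. *)
Lemma path_dev_nilpotent D (rho M : R) (beta : 'I_D -> 'M[R]_2) x g :
  g 0 = 0 ->
  (forall u, apply_form beta (x u) = g u *: delta_mx 0 1) ->
  (forall u v, 0 <= u <= 1 -> 0 <= v <= 1 ->
     `|g u - g v| <= M * `|u - v| `^ rho) ->
  path_dev rho beta x = 1%:M + g 1 *: delta_mx 0 1.
Proof.
move=> g0 xg gM.
have {}xg : (fun u => apply_form beta (x u)) = (fun u => g u *: N).
  exact/funext.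
apply: (@path_dev_eq _ _ _ _ _ _ (fun u => 1%:M + g u *: N)).
  split; last 2 first.
  - by rewrite g0 scale0r addr0.
  - move=> t _; rewrite xg; apply: mesh_cvg_cst => s ps.
    rewrite [RHS]addrAC subrr add0r.
    have := partition_telescope (fun u => g u *: N) ps.
    rewrite /= g0 scale0r subr0 => <-.
    apply: eq_bigr => i _; rewrite -scalerBl -scalemxAr mulmxDl mul1mx.
    by rewrite -scalemxAl NN scaler0 addr0.
  - exists (M * `|N|) => u v; rewrite !in_itv/= => u01 v01.
    rewrite opprD addrACA subrr add0r -scalerBl normrZ mulrAC.
    by rewrite ler_wpM2r// gM.
move=> F' [_ _]; rewrite xg => F'int.
have col0 t i : 0 <= t <= 1 -> F' t i 0 = (i == 0)%:R.
  move=> t01; have t0 : 0 <= t by lra.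
  have /F'int/young_int_entry/(_ i 0) int : t \in `[0, 1] by rewrite in_itv.
  have pF := mesh_filter_proper t0.
  have /(cvg_unique _ int) : (fun s => \sum_k young_sum (@GRing.mul R)
      (fun u => F' u i k) (fun u => (g u *: N) k 0) 0 s)
      @ mesh_filter 0 t --> (0 : R).
    apply: mesh_cvg_cst => s _; apply: big1 => k _; apply: big1 => j _.
    by rewrite !mxE/= andbF !mulr0 subrr mulr0.
  by rewrite !mxE => /(_ (@norm_hausdorff _ _))/eqP; rewrite subr_eq0 => /eqP.
apply/matrixP => i j; rewrite !mxE; have [->|j1] := eqVneq j 0.
  by rewrite col0 ?ler01 ?lexx// andbF mulr0 addr0.
have {j1}-> : j = 1 by apply/val_inj; case: j j1 => [[|[|]]].
have /F'int/young_int_entry/(_ i 1) int : (1 : R) \in `[0, 1].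
  by rewrite in_itv/= ler01 lexx.
have pF := mesh_filter_proper (@ler01 R).
have /(cvg_unique _ int) : (fun s => \sum_k young_sum (@GRing.mul R)
      (fun u => F' u i k) (fun u => (g u *: N) k 1) 0 s)
      @ mesh_filter 0 1 --> (i == 0)%:R * g 1.
  apply: mesh_cvg_cst => s ps.
  rewrite big_ord_recl big_ord1 [X in _ + X]big1 ?addr0; last first.
    by move=> l _; rewrite !mxE/= !mulr0 subrr mulr0.
  have := partition_telescope g ps; rewrite g0 subr0 => <-; rewrite mulr_sumr.
  rewrite /young_sum !big_nat; apply: eq_bigr => l /= ls.
  rewrite !mxE/= !mulr1 col0//.
  by have := part_pt_itv ps (ltnW ls).
rewrite !mxE => /(_ (@norm_hausdorff _ _))/eqP; rewrite subr_eq => /eqP ->.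
by rewrite addrC andbT [g 1 * _]mulrC.
Qed.

End NilpotentDevelopment.

(** * The separating family of 2-connections *)

Section Connection.
Context {R : realType} {d : nat}.
Set Implicit Arguments.
Unset Strict Implicit.

Definition crd_s : 'I_(2 + d) := lshift (1 + d) (ord0 : 'I_1).
Definition crd_t : 'I_(2 + d) := rshift 1 (lshift d (ord0 : 'I_1)).
Definition crd_x (i : 'I_d) : 'I_(2 + d) := rshift 1 (rshift 1 i).

Lemma param_surface_s (X : R -> R -> 'rV[R]_d) s t :
  param_surface X s t 0 crd_s = s.
Proof. by apply: etrans (row_mxEl _ _ 0 ord0) _; rewrite mxE. Qed.

Lemma param_surface_t (X : R -> R -> 'rV[R]_d) s t :
  param_surface X s t 0 crd_t = t.
Proof.
apply: etrans (row_mxEr (s%:M : 'rV_1) _ 0 (lshift d ord0)) _.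
by rewrite row_mxEl mxE.
Qed.

Lemma param_surface_x (X : R -> R -> 'rV[R]_d) i s t :
  param_surface X s t 0 (crd_x i) = X s t 0 i.
Proof.
apply: etrans (row_mxEr (s%:M : 'rV_1) _ 0 (rshift 1 i)) _.
exact: row_mxEr.
Qed.

(** The other three blocks are empty. Both sides have the same type because [0 + m] computes to
    [m]. *)
Lemma block_mx00 m p (A : 'M[R]_0) (B : 'M[R]_(0, p)) (C : 'M[R]_(m, 0)) M :
  block_mx A B C M = M :> 'M[R]_(0 + m, 0 + p).
Proof.
apply/matrixP => i j; rewrite !mxE.
case: splitP => [[]//|k ik]; rewrite !mxE; case: splitP => [[]//|l jl].
by congr (M _ _); apply: val_inj.
Qed.

Definition scalar_form (a b : R) (k : 'I_(2 + d)) : 'M[R]_1 :=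
  if k == crd_s then a%:M else if k == crd_t then b%:M else 0.

Definition nilpotent_form (i : 'I_d) (k : 'I_(2 + d)) : 'M[R]_2 :=
  if k == crd_x i then delta_mx 0 1 else 0.

(** The coefficient is the row (1, 0), which right multiplication by [1 - c N] turns into (1, -c):
    its second entry reads off a coordinate of the surface. *)
Definition st_form (k l : 'I_(2 + d)) : 'M[R]_(1, 2) :=
  if (k == crd_s) && (l == crd_t) then delta_mx 0 0 else 0.

Lemma apply_scalar_form a b v :
  apply_form (scalar_form a b) v = (a * v 0 crd_s + b * v 0 crd_t)%:M.
Proof.
rewrite /apply_form (bigD1 crd_s)//= (bigD1 crd_t)//= big1 ?addr0.
  rewrite /scalar_form eqxx -[crd_t == _]/false eqxx.
  by rewrite !scale_scalar_mx -raddfD/= ![v 0 _ * _]mulrC.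
move=> k /andP[/negPf ks /negPf kt].
by rewrite /scalar_form ks kt scaler0.
Qed.

Lemma apply_nilpotent_form i v :
  apply_form (nilpotent_form i) v = v 0 (crd_x i) *: delta_mx 0 1.
Proof.
rewrite /apply_form (bigD1 (crd_x i))//= big1 ?addr0.
  by rewrite /nilpotent_form eqxx.
by move=> k /negPf ki; rewrite /nilpotent_form ki scaler0.
Qed.

(** The prescribed blocks of [gamma] are empty and [st_form] is the free one. What remains is
    commutation: 1 by 1 matrices commute, and products of values of [nilpotent_form] vanish. *)
Lemma conn_axiom_st a b i :
  @is_mx_2connection R (2 + d) 0 1 2 (scalar_form a b) (nilpotent_form i)
    st_form.
Proof.
exists (fun=> 0), (fun=> 0), (scalar_form a b), (fun=> 0), (nilpotent_form i),
  st_form; split=> *; rewrite ?block_mx00//.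
- apply/matrixP => k l; rewrite !ord1 !mxE !big_ord1.
  by rewrite [X in _ - X]mulrC subrr.
- rewrite /nilpotent_form; case: ifP => _; case: ifP => _;
    by rewrite ?mulmx0 ?mul0mx ?mul_delta_mx_0 ?subrr.
Qed.

Definition conn_st a b i : mx_2connection R (2 + d) 0 1 2 :=
  Mx2Connection (conn_axiom_st a b i).

Lemma conn_phi0 m p : conn_phi R 0 m p = 0.
Proof. exact: block_mx00. Qed.

End Connection.

(** * The area process in the two parameter coordinates *)

Section AreaProcess.
Context {R : realType} {d : nat}.
Set Implicit Arguments.
Unset Strict Implicit.
Implicit Types (X : R -> R -> 'rV[R]_d) (a b s t : R).

(** In these coordinates the loop runs around the rectangle whatever [X] is, so the integral is the
    area of the rectangle. *)
Lemma area_process_st X s t : 0 <= s <= 1 -> 0 <= t <= 1 ->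
  area_process (param_surface X) crd_s crd_t s t = s * t.
Proof.
move=> s01 t01.
pose p u : R := if u <= 4^-1 then 4 * u else if u <= 2^-1 then 1
  else if u <= 3 / 4 then 3 - 4 * u else 0.
pose q u : R := if u <= 4^-1 then 0 else if u <= 2^-1 then 4 * u - 1
  else if u <= 3 / 4 then 1 else 4 - 4 * u.
(* [k] is the integral of [p dq]. It grows only on the right side, where [p = 1]: [q] is constant on
   the horizontal sides, and [p = 0] on the left one. *)
pose k u : R := if u <= 4^-1 then 0 else if u <= 2^-1 then 4 * u - 1 else 1.
rewrite /area_process/=.
have -> : (fun u => boundary_loop (param_surface X) s t u 0 crd_s) =
    (fun u => p u * s).
  apply/funext => u; rewrite /boundary_loop /p.
  by do ?case: ifP => _; rewrite param_surface_s ?mul1r ?mul0r.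
have -> : (fun u => boundary_loop (param_surface X) s t u 0 crd_t) =
    (fun u => q u * t).
  apply/funext => u; rewrite /boundary_loop /q.
  by do ?case: ifP => _; rewrite param_surface_t ?mul1r ?mul0r.
apply: young_intE; first exact: ler01.
have -> : s * t = k 1 * s * t - k 0 * s * t.
  by rewrite /k; do ?case: ifP => ?; lra.
(* [p] and [q] are 4-Lipschitz, so freezing [p] at its left value costs at most
   [4 * 4 * (v - u) ^+ 2]. *)
apply: (@young_int_quadratic _ (fun u => k u * s * t) _ _ _ _ 16) => //.
move=> u v u0 uv v1.
have -> : young_int (W := R^o) (@GRing.mul R) (fun=> 1) (fun u => p u * s) 0 u
    = p u * s.
  apply: young_intE => //; apply: mesh_cvg_cst => r pr.
  have := partition_telescope (fun u => p u * s) pr.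
  have -> : p 0 = 0 by rewrite /p; case: ifP => ?; lra.
  by rewrite mul0r subr0 => <-; apply: eq_bigr => l _; exact: mul1r.
have -> : k v * s * t - k u * s * t - p u * s * (q v * t - q u * t) =
  (s * t) * (k v - k u - p u * (q v - q u)) by ring.
rewrite normrM ger0_norm ?mulr_ge0//; [|lra|lra].
have : `|k v - k u - p u * (q v - q u)| <= 16 * (v - u) ^+ 2.
  rewrite /p /q /k ler_norml.
  have [u1|u1] := leP u 4^-1.
    have [w1|w1] := leP v 4^-1; first nra.
    by have [w2|w2] := leP v 2^-1; [|have [w3|w3] := leP v (3 / 4)]; nra.
  have [w1|w1] := leP v 4^-1; first lra.
  have [u2|u2] := leP u 2^-1.
    by have [w2|w2] := leP v 2^-1; [|have [w3|w3] := leP v (3 / 4)]; nra.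
  have [w2|w2] := leP v 2^-1; first lra.
  have [u3|u3] := leP u (3 / 4).
    by have [w3|w3] := leP v (3 / 4); nra.
  by have [w3|w3] := leP v (3 / 4); nra.
move=> le16; apply: le_trans le16.
by rewrite ler_piMl//; nra.
Qed.

End AreaProcess.

(** * Developments along tail paths *)

Section TailDevelopments.
Context {R : realType} {d : nat}.
Set Implicit Arguments.
Unset Strict Implicit.
Implicit Types (X : R -> R -> 'rV[R]_d) (a b s t rho : R).

Lemma path_dev_tail_scalar X a b rho s t : 0 <= a -> 0 <= b ->
  0 <= rho <= 1 -> 0 <= s <= 1 -> 0 <= t <= 1 ->
  path_dev rho (scalar_form a b) (tail_path (param_surface X) s t)
  = (expR (a * s + b * t))%:M.
Proof.
move=> a0 b0 rho01 s01 t01.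
pose g u : R := if u <= 2^-1 then b * (2 * u * t)
  else a * ((2 * u - 1) * s) + b * t.
have -> : a * s + b * t = g 1 by rewrite /g; case: ifP => ?; lra.
(* The two legs, run at double speed, have slopes at most [2 * b] and [2 * a]; the [+ 1] makes the
   constant positive when [a = b = 0]. *)
apply: (@path_dev_scalar _ _ _ (2 * (a + b) + 1)) => //; first lra.
- by rewrite /g; case: ifP => ?; lra.
- move=> u; rewrite apply_scalar_form /tail_path /g; case: ifP => _;
    by rewrite param_surface_s param_surface_t ?mulr0 ?add0r.
have as0 : 0 <= a * s <= a by nra.
have bt0 : 0 <= b * t <= b by nra.
move=> u v u0 uv v1; rewrite /g.
have [u2|u2] := leP u 2^-1; have [v2|v2] := leP v 2^-1; try lra; nra.
Qed.

Lemma path_dev_tail_nilpotent X i rho s t : 0 <= rho <= 1 ->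
  holder_surface0 rho X -> 0 <= s <= 1 -> 0 <= t <= 1 ->
  path_dev rho (nilpotent_form i) (tail_path (param_surface X) s t)
  = 1%:M + X s t 0 i *: delta_mx 0 1.
Proof.
move=> rho01 [[_ [M [XM Xs Xt _]]] X00] s01 t01.
have M0 : 0 <= M.
  by apply: le_trans (normr_ge0 _) (XM 0 0 _ _); rewrite in_itv/= lexx ler01.
pose g u : R := if u <= 2^-1 then X 0 (2 * u * t) 0 i
  else X ((2 * u - 1) * s) t 0 i.
have -> : X s t 0 i = g 1.
  rewrite /g; case: ifP => [|_]; first by lra.
  by congr (X _ _ _ _); lra.
have entry (V W : 'rV[R]_d) c : `|V - W| <= c -> `|V 0 i - W 0 i| <= c.
  move=> VW; have -> : V 0 i - W 0 i = (V - W) 0 i by rewrite !mxE.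
  exact: le_trans (mx_entry_le _ _ _) VW.
have pow c w : 0 <= w -> 0 <= c <= 1 -> (2 * w * c) `^ rho <= 2 * w `^ rho.
  move=> w0 c01; apply: (@le_trans _ _ ((2 * w) `^ rho)).
    by apply: ge0_ler_powR; rewrite ?nnegrE; nra.
  rewrite powRM// ler_wpM2r ?powR_ge0//.
  by apply: ler1_powR; lra.
have g1 u v : 0 <= u -> u <= v -> v <= 2^-1 ->
    `|g u - g v| <= M * (2 * (v - u) `^ rho).
  move=> u0 uv v2; rewrite /g (le_trans uv v2) v2.
  apply/entry; apply: le_trans (Xt _ _ _ _ _ _) _; rewrite ?in_itv/=; try nra.
  rewrite ler_wpM2l// distrC.
  have -> : 2 * v * t - 2 * u * t = 2 * (v - u) * t by ring.
  rewrite ger0_norm; last by nra.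
  by apply: pow => //; lra.
have g2' u v : 2^-1 <= u -> u <= v -> v <= 1 ->
    `|X ((2 * u - 1) * s) t 0 i - X ((2 * v - 1) * s) t 0 i|
      <= M * (2 * (v - u) `^ rho).
  move=> u2 uv v1.
  apply/entry; apply: le_trans (Xs _ _ _ _ _ _) _; rewrite ?in_itv/=; try nra.
  rewrite ler_wpM2l// distrC.
  have -> : (2 * v - 1) * s - (2 * u - 1) * s = 2 * (v - u) * s by ring.
  rewrite ger0_norm; last by nra.
  by apply: pow => //; lra.
(* The midpoint belongs to the first branch; the branches agree there, so the second formula is
   valid on the closed half. *)
have g_half : g 2^-1 = X ((2 * 2^-1 - 1) * s) t 0 i.
  rewrite /g lexx; congr (X _ _ _ _); lra.
have g2 u v : 2^-1 <= u -> u <= v -> v <= 1 ->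
    `|g u - g v| <= M * (2 * (v - u) `^ rho).
  have gE w : 2^-1 <= w -> g w = X ((2 * w - 1) * s) t 0 i.
    rewrite le_eqVlt => /predU1P[<- //|w2]; rewrite /g.
    by case: ifP => // ?; lra.
  by move=> u2 uv v1; rewrite !gE//; [exact: g2'|lra].
(* Each leg has Hölder constant [2 * M], and an interval containing the midpoint collects both. *)
apply: (@path_dev_nilpotent _ _ _ (M * 4)).
- rewrite /g; case: ifP => [_|]; last by lra.
  by rewrite mulr0 mul0r X00 mxE.
- move=> u; rewrite apply_nilpotent_form /tail_path /g.
  by case: ifP => _; rewrite param_surface_x.
move=> u v; wlog uv : u v / u <= v.
  move=> wl u01 v01; have [uv|/ltW vu] := leP u v; first exact: wl.
  by rewrite distrC [`|u - v|]distrC; exact: wl.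
move=> u01 v01; rewrite [`|u - v|]distrC [`|v - u|]ger0_norm; last by lra.
have P0 : 0 <= (v - u) `^ rho by exact: powR_ge0.
have MP : 0 <= M * (v - u) `^ rho by exact: mulr_ge0.
have [v2|v2] := leP v 2^-1.
  by apply: (le_trans (g1 _ _ _ uv v2)); [lra|nra].
have [u2|/ltW u2] := leP u 2^-1; last first.
  by apply: (le_trans (g2 _ _ u2 uv _)); [lra|nra].
have h1 := g1 u 2^-1 (proj1 (andP u01)) u2 (lexx _).
have h2 := g2 2^-1 v (lexx _) (ltW v2) (proj2 (andP v01)).
have le_pow w : 0 <= w <= v - u -> M * (2 * w `^ rho) <= M * (2 * (v - u) `^ rho).
  move=> wvu; rewrite ler_wpM2l// ler_wpM2l//.
  by apply: ge0_ler_powR; rewrite ?nnegrE; lra.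
have := le_pow (2^-1 - u); have := le_pow (v - 2^-1).
have := ler_distD (g 2^-1) (g u) (g v); lra.
Qed.

End TailDevelopments.

(** * Evaluation of the surface development on the family *)

Section SurfaceDevelopment.
Context {R : realType} {d : nat}.
Set Implicit Arguments.
Unset Strict Implicit.
Implicit Types (X : R -> R -> 'rV[R]_d) (a b s t rho : R).

Lemma cvg_mesh_prod (V : normedModType R) (F : seq R * seq R -> V) (w : V) t :
  (forall eps, 0 < eps -> exists2 e, 0 < e & forall P Q,
    itv_partition 0 1 P -> mesh_lt 0 P e ->
    itv_partition 0 t Q -> mesh_lt 0 Q e -> `|w - F (P, Q)| <= eps) ->
  F @ filter_prod (mesh_filter 0 1) (mesh_filter 0 t) --> w.
Proof.
move=> h; apply/cvgrPdist_le => eps /h[e e0 he].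
exists ([set P | itv_partition 0 1 P /\ mesh_lt 0 P e],
        [set Q | itv_partition 0 t Q /\ mesh_lt 0 Q e]).
  by split; apply: near_mesh; exists e.
by case=> P Q [/= [pP mP] [pQ mQ]]; exact: he.
Qed.

Lemma young_int2E (V : normedModType R) (f : R -> R -> V) g t (w : V) :
  0 <= t ->
  young_sum2 f g 0 0 @ filter_prod (mesh_filter 0 1) (mesh_filter 0 t) --> w ->
  young_int2 f g 0 1 0 t = w.
Proof.
move=> t0 fw; have p1 := mesh_filter_proper (@ler01 R).
have pt := mesh_filter_proper t0.
exact: cvg_lim fw.
Qed.

Definition exp_weight a b s t : R := expR (a * s + b * t).

Lemma ucont2_exp_weight a b : 0 <= a -> 0 <= b -> ucont2 (exp_weight a b).
Proof.
(* [expR (a + b) * (a + b)] is a Lipschitz constant of the weight for the maximum distance; the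
   [+ 1] makes [C] positive. *)
move=> a0 b0 eps eps0; pose C := expR (a + b) * (a + b) + 1.
have E0 := expR_gt0 (a + b).
have C0 : 0 < C by rewrite /C; nra.
exists (eps / C); first by rewrite divr_gt0.
move=> s s' t t' s01 s'01 t01 t'01 ss' tt'.
have dE x y : x <= a + b -> y <= a + b ->
    `|expR x - expR y| <= expR (a + b) * `|x - y|.
  wlog xy : x y / x <= y.
    move=> wl x1 y1; have [xy|/ltW yx] := leP x y; first exact: wl.
    by rewrite distrC [`|x - y|]distrC; exact: wl.
  move=> x1 y1; rewrite distrC [`|x - y|]distrC.
  have := expR_diff_ge x y; have := expR_diff_ge y x.
  have : expR y <= expR (a + b) by rewrite ler_expR.
  have := expR_gt0 x; have := expR_gt0 y => *.
  rewrite !ger0_norm; nra.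
apply: (le_trans (dE _ _ _ _)); [nra|nra|].
apply: (@le_trans _ _ (expR (a + b) * ((a + b) * (eps / C)))).
  rewrite ler_wpM2l ?(ltW E0)//; move: ss' tt'; rewrite !ltr_norml ler_norml.
  move: (eps / C) => e ? ?.
  have -> : a * s + b * t - (a * s' + b * t') = a * (s - s') + b * (t - t').
    by ring.
  nra.
rewrite !mulrA ler_pdivrMr// mulrC ler_wpM2l ?(ltW eps0)// /C; lra.
Qed.

Lemma bounded2_exp_weight a b : 0 <= a -> 0 <= b ->
  bounded2 (exp_weight a b) (expR (a + b)).
Proof.
move=> a0 b0 s t s01 t01; rewrite ger0_norm ?expR_ge0// ler_expR; nra.
Qed.

Lemma holder_bounded2 X i rho : holder_surface rho X ->
  exists M, bounded2 (fun s t => X s t 0 i) M.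
Proof.
move=> [_ [M [XM _ _ _]]]; exists M => s t s01 t01.
by apply: le_trans (mx_entry_le _ _ _) (XM _ _ _ _); rewrite in_itv.
Qed.

Lemma holder_ucont2 X i rho : 0 < rho -> holder_surface rho X ->
  ucont2 (fun s t => X s t 0 i).
Proof.
move=> rho0 [_ [M [XM Xs Xt _]]] eps eps0.
have M0 : 0 <= M.
  by apply: le_trans (normr_ge0 _) (XM 0 0 _ _); rewrite in_itv/= lexx ler01.
pose c := eps / (2 * M + 1).
have c0 : 0 < c by rewrite divr_gt0//; lra.
exists (c `^ rho^-1); first exact: powR_gt0.
move=> s s' t t' s01 s'01 t01 t'01 ss' tt'.
have pow z : `|z| < c `^ rho^-1 -> `|z| `^ rho <= c.
  move=> zc; have -> : c = (c `^ rho^-1) `^ rho.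
    by rewrite -powRrM mulVf ?gt_eqF// powRr1// ltW.
  by apply: ge0_ler_powR; rewrite ?nnegrE ?normr_ge0 ?powR_ge0// ltW.
have -> : X s t 0 i - X s' t' 0 i = (X s t - X s' t') 0 i by rewrite !mxE.
apply: (le_trans (mx_entry_le _ _ _)).
apply: (le_trans (ler_distD (X s' t) _ _)).
apply: (@le_trans _ _ (M * c + M * c)).
  apply: lerD.
    apply: (le_trans (Xs _ _ _ _ _ _)); rewrite ?in_itv//.
    by rewrite ler_wpM2l// pow.
  apply: (le_trans (Xt _ _ _ _ _ _)); rewrite ?in_itv//.
  by rewrite ler_wpM2l// pow.
rewrite -mulrDl /c mulrA ler_pdivrMr; [nra|lra].
Qed.

(** Supplies the Hölder clause of [solves_surface_dev]. *)
Lemma segint2_lipschitz (f : R -> R -> R) (M : R) : ucont2 f -> bounded2 f M ->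
  forall u v, 0 <= u <= 1 -> 0 <= v <= 1 ->
    `|segint2 f u - segint2 f v| <= M * `|u - v|.
Proof.
move=> cf bf u v; wlog uv : u v / u <= v.
  move=> wl u01 v01; have [uv|/ltW vu] := leP u v; first exact: wl.
  by rewrite distrC [`|u - v|]distrC; exact: wl.
move=> u01 v01; rewrite distrC [`|u - v|]distrC [`|v - u|]ger0_norm; last by lra.
have ck := cont01_segint cf.
rewrite /segint2 (@segint_cat _ _ 0 u v) ?ck//; try lra.
rewrite addrAC subrr add0r.
have := @segint_dist _ (fun t => segint (f ^~ t) 0 1) u v 0 M.
rewrite mul0r !subr0; apply => //; try lra.
move=> t tuv; have t01 : 0 <= t <= 1 by lra.
have := @segint_dist _ (f ^~ t) 0 1 0 M.
rewrite mul0r !subr0 mulr1; apply => //; first exact: ucont2_section.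
by move=> s s01; rewrite subr0; exact: bf.
Qed.

Definition wx a b X i s t : R := exp_weight a b s t * X s t 0 i.

(** The square increments of [s * t] are products of lengths, so the Young sums become Riemann sums
    of two scalar functions. *)
Lemma surface_Z_st X a b i rho t : 0 <= a -> 0 <= b ->
  0 < rho <= 1 -> holder_surface0 rho X -> 0 <= t <= 1 ->
  surface_Z rho (conn_st a b i) (param_surface X) 1 t =
    segint2 (exp_weight a b) t *: (delta_mx 0 0 : 'M[R]_(1, 2))
    - segint2 (wx a b X i) t *: (delta_mx 0 1 : 'M[R]_(1, 2)).
Proof.
move=> a0 b0 rho01 hX t01.
have t0 : 0 <= t by lra.
have rho01' : 0 <= rho <= 1 by lra.
(* [gamma] vanishes on these pairs, so each Young sum is zero term by term. *)
have off (k l : 'I_(2 + d)) : ~~ ((k == crd_s) && (l == crd_t)) ->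
    young_int2 (fun s' t' =>
      path_dev rho (conn_alpha (conn_st a b i))
        (tail_path (param_surface X) s' t')
      *m conn_gamma (conn_st a b i) k l
      *m invmx (path_dev rho (conn_beta (conn_st a b i))
        (tail_path (param_surface X) s' t')))
      (area_process (param_surface X) k l) 0 1 0 t = 0.
  move=> /negPf kl; apply: young_int2E => //; apply: cvg_mesh_prod => eps eps0.
  exists 1 => // P Q _ _ _ _; rewrite /young_sum2 big1 ?subrr ?normr0 ?ltW//.
  move=> m _; apply: big1 => n _; rewrite /= /st_form kl.
  by rewrite mulmx0 mul0mx scaler0.
rewrite /surface_Z (bigD1 crd_s)//= (bigD1 crd_t)//= addrC big1; last first.
  move=> k ks; apply: big1 => l _; apply: off.
  by rewrite (negPf ks).
rewrite add0r addrC big1; last first.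
  by move=> l /andP[_ lt]; apply: off; rewrite (negPf lt) andbF.
rewrite add0r; apply: young_int2E => //.
pose W (f : R -> R -> R) (PQ : seq R * seq R) : R :=
  \sum_(0 <= k < size PQ.1) \sum_(0 <= l < size PQ.2)
    (part_pt 0 PQ.1 k.+1 - part_pt 0 PQ.1 k)
    * (part_pt 0 PQ.2 l.+1 - part_pt 0 PQ.2 l)
    * f (part_pt 0 PQ.1 k) (part_pt 0 PQ.2 l).
have Wcvg f : ucont2 f ->
    W f @ filter_prod (mesh_filter 0 1) (mesh_filter 0 t) --> segint2 f t.
  move=> cf; apply: (@cvg_mesh_prod R^o) => eps eps0.
  exact: (segint2_Riemann_sum cf t01 eps0).
have cE := ucont2_exp_weight a0 b0.
have cwx : ucont2 (wx a b X i).
  have [M bX] := holder_bounded2 i (proj1 hX).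
  apply: ucont2M (bounded2_exp_weight a0 b0) bX cE _.
  by apply: (holder_ucont2 i _ (proj1 hX)); lra.
have lim : (fun PQ => W (exp_weight a b) PQ *: (delta_mx 0 0 : 'M[R]_(1, 2))
      - W (wx a b X i) PQ *: (delta_mx 0 1 : 'M[R]_(1, 2)))
    @ filter_prod (mesh_filter 0 1) (mesh_filter 0 t) -->
    segint2 (exp_weight a b) t *: (delta_mx 0 0 : 'M[R]_(1, 2))
    - segint2 (wx a b X i) t *: (delta_mx 0 1 : 'M[R]_(1, 2)).
  by apply: cvgB; apply: cvgZr_tmp; exact: Wcvg.
(* The formulas for the area and the developments are available on the unit square only, where all
   partition points lie, so the sums are compared partition by partition. *)
apply: (cvg_trans _ lim); apply: near_eq_cvg.
exists (itv_partition 0 1, itv_partition 0 t).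
  by split; apply: near_mesh; exists 1.
case=> P Q [/= pP pQ]; rewrite /young_sum2 /W /= !scaler_suml -sumrB.
rewrite !big_nat; apply: eq_bigr => k /= kP.
rewrite !scaler_suml -sumrB.
rewrite !big_nat; apply: eq_bigr => l /= lQ.
have p01 := part_pt_itv pP (ltnW kP); have q01 := part_pt_itv pQ (ltnW lQ).
have p01' := part_pt_itv pP kP; have q01' := part_pt_itv pQ lQ.
rewrite /square_incr !area_process_st; [|lra..].
have -> := @path_dev_tail_scalar _ _ X a b rho (part_pt 0 P k) (part_pt 0 Q l)
  a0 b0 rho01'; [|lra..].
have -> := @path_dev_tail_nilpotent _ _ X i rho (part_pt 0 P k) (part_pt 0 Q l)
  rho01' hX; [|lra..].
rewrite invmx_1Ddelta /st_form !eqxx/= mulmxBr mulmx1 -scalemxAr.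
rewrite mul_scalar_mx -scalemxAl mul_delta_mx.
rewrite scalerBr !scalerA /wx /exp_weight; congr (_ *: _ - _ *: _); ring.
Qed.

Let scaleBB (V : lmodType R) (p q p' q' : R) (v w : V) :
  (p *: v - p' *: w) - (q *: v - q' *: w) = (p - q) *: v - (p' - q') *: w.
Proof.
by rewrite !scalerBl !opprB [X in _ + X = _]addrC addrACA [X in _ + X = _]addrC.
Qed.

(** As [conn_phi] vanishes, the Young sum of any candidate [h] telescopes to the increment of [Z].
    The same computation [sumE] therefore yields existence and uniqueness. *)
Lemma surface_dev_st X a b i rho : 0 <= a -> 0 <= b ->
  0 < rho <= 1 -> holder_surface0 rho X ->
  surface_dev rho (conn_st a b i) (param_surface X) =
    segint2 (exp_weight a b) 1 *: (delta_mx 0 0 : 'M[R]_(1, 2))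
    - segint2 (wx a b X i) 1 *: (delta_mx 0 1 : 'M[R]_(1, 2)).
Proof.
move=> a0 b0 rho01 hX.
have rho01' : 0 <= rho <= 1 by lra.
pose d0 : 'M[R]_(0 + 1, 0 + 2) := delta_mx (0 : 'I_1) (0 : 'I_2).
pose d1 : 'M[R]_(0 + 1, 0 + 2) := delta_mx (0 : 'I_1) (1 : 'I_2).
pose Z t : 'M[R]_(0 + 1, 0 + 2) :=
  segint2 (exp_weight a b) t *: d0 - segint2 (wx a b X i) t *: d1.
have ZE t : 0 <= t <= 1 ->
    surface_Z rho (conn_st a b i) (param_surface X) 1 t = Z t.
  exact: surface_Z_st.
have Z0 : Z 0 = 0 by rewrite /Z /segint2 !segintxx !scale0r subrr.
have [M bX] := holder_bounded2 i (proj1 hX).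
have bE := bounded2_exp_weight a0 b0.
have cE := ucont2_exp_weight a0 b0.
have cwx : ucont2 (wx a b X i).
  apply: ucont2M bE bX cE _.
  by apply: (holder_ucont2 i _ (proj1 hX)); lra.
have bwx : bounded2 (wx a b X i) (expR (a + b) * M).
  by move=> s t s01 t01; rewrite normrM ler_pM//; [exact: bE|exact: bX].
have sumE h t (s : seq R) : 0 <= t <= 1 -> itv_partition 0 t s ->
    young_sum mulmx (fun u => 1%:M + h u *m conn_phi R 0 1 2)
      (surface_Z rho (conn_st a b i) (param_surface X) 1) 0 s = Z t.
  move=> t01 ps; have := partition_telescope Z ps; rewrite Z0 subr0 => <-.
  rewrite /young_sum !big_nat; apply: eq_bigr => k /= ks.
  have p := part_pt_itv ps ks; have p' := part_pt_itv ps (ltnW ks).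
  by rewrite conn_phi0 mulmx0 addr0 mul1mx !ZE//; lra.
apply: xget_unique.
  exists Z => //; split=> //.
    exists (expR (a + b) * `|d0| + expR (a + b) * M * `|d1|) => u v.
    rewrite !in_itv/= => u01 v01.
    have uv_le : `|u - v| <= `|u - v| `^ rho.
      apply: powR_ge_id; last by lra.
      by rewrite normr_ge0 ler_norml; lra.
    rewrite [Z u - Z v]scaleBB.
    apply: (le_trans (ler_normB _ _)); rewrite !normrZ.
    have hE := segint2_lipschitz cE bE u01 v01.
    have hw := segint2_lipschitz cwx bwx u01 v01.
    rewrite mulrDl ![_ * `|_| * (_ `^ _)]mulrAC.
    have C1 : 0 <= expR (a + b) by exact: expR_ge0.
    have C2 : 0 <= expR (a + b) * M.
      by apply: le_trans (bwx 0 0 _ _); rewrite ?lexx ?ler01.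
    apply: lerD; apply: ler_wpM2r => //.
      by apply: (le_trans hE); exact: ler_wpM2l.
    by apply: (le_trans hw); exact: ler_wpM2l.
  move=> t; rewrite in_itv/= => t01; apply: mesh_cvg_cst => s ps.
  exact: sumE.
move=> _ [h [_ _ hint] <-].
have /hint hint1 : (1 : R) \in `[0, 1] by rewrite in_itv/= ler01 lexx.
apply: (young_int_unique (@ler01 R) hint1).
by apply: mesh_cvg_cst => s ps; apply: sumE => //; rewrite ler01 lexx.
Qed.

Lemma surface_dev_st_entry X a b i rho : 0 <= a -> 0 <= b ->
  0 < rho <= 1 -> holder_surface0 rho X ->
  surface_dev rho (conn_st a b i) (param_surface X) (0 : 'I_1) (1 : 'I_2) =
    - segint2 (wx a b X i) 1.
Proof.
move=> a0 b0 rho01 hX.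
have entry (p q : R) : (p *: (delta_mx 0 0 : 'M[R]_(1, 2))
    - q *: (delta_mx 0 1 : 'M[R]_(1, 2))) 0 1 = - q.
  by rewrite !mxE/= mulr0 mulr1 sub0r.
rewrite -(entry (segint2 (exp_weight a b) 1)).
by rewrite -(surface_dev_st i a0 b0 rho01 hX).
Qed.

End SurfaceDevelopment.

(** * Separation of surfaces by inverting the double Laplace transform *)

Theorem theorem7p1 (R : realType) (d : nat) (rho : R)
    (X Y : R -> R -> 'rV[R]_d) :
  (1 <= d)%N -> 2^-1 < rho <= 1 ->
  holder_surface0 rho X -> holder_surface0 rho Y ->
  ~ (forall s t : R, s \in `[0, 1] -> t \in `[0, 1] -> X s t = Y s t) ->
  exists (n m p : nat) (w : mx_2connection R (2 + d) n m p),
    surface_dev rho w (param_surface X) <> surface_dev rho w (param_surface Y).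
Proof.
move=> _ rho1 hX hY XY; apply: contrapT => noconn; apply: XY => s0 t0.
rewrite !in_itv/= => s01 t01; apply/rowP => i.
have rho01 : 0 < rho <= 1 by lra.
have moments (a b : nat) : segint2 (wx a%:R b%:R X i) 1
    = segint2 (wx a%:R b%:R Y i) 1.
  have : surface_dev rho (conn_st a%:R b%:R i) (param_surface X) =
      surface_dev rho (conn_st a%:R b%:R i) (param_surface Y).
    apply: contrapT => ne; apply: noconn.
    by exists 0, 1, 2, (conn_st a%:R b%:R i).
  move=> H; apply: oppr_inj.
  rewrite -(surface_dev_st_entry i (ler0n R a) (ler0n R b) rho01 hX).
  by rewrite -(surface_dev_st_entry i (ler0n R a) (ler0n R b) rho01 hY) H.
have bc Z (hZ : holder_surface0 rho Z) a b : 0 <= a -> 0 <= b ->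
    ucont2 (wx a b Z i).
  move=> a0 b0; have [M bZ] := holder_bounded2 i (proj1 hZ).
  apply: ucont2M (bounded2_exp_weight a0 b0) bZ (ucont2_exp_weight a0 b0) _.
  by apply: (holder_ucont2 i _ (proj1 hZ)); lra.
(* Pulling [expR (b * t)] out of the inner integral turns the double integral into an exponential
   moment in [t], with [a] as a parameter. *)
have wxE (Z : R -> R -> 'rV[R]_d) a b s t :
    wx a b Z i s t = expR (b * t) * wx a 0 Z i s t.
  by rewrite /wx /exp_weight mulrA -expRD mul0r addr0 addrC.
have section Z (hZ : holder_surface0 rho Z) (a b : nat) :
    segint2 (wx a%:R b%:R Z i) 1 =
    segint (fun t => expR t ^+ b * segint (wx a%:R 0 Z i ^~ t) 0 1) 0 1.
  apply: eq_segint => t t01'; rewrite -expRM_natl -segintZl//.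
    by apply: eq_segint => s _; exact: wxE.
  by apply: ucont2_section => //; exact: bc.
have csec Z (hZ : holder_surface0 rho Z) (a : nat) :
    cont01 (fun t => segint (wx a%:R 0 Z i ^~ t) 0 1).
  by apply: cont01_segint; exact: bc.
(* Injectivity in [t]: here [a] is fixed and [b] varies. *)
have kt (a : nat) t : 0 <= t <= 1 ->
    segint (wx a%:R 0 X i ^~ t) 0 1 = segint (wx a%:R 0 Y i ^~ t) 0 1.
  move=> t01'; apply/eqP; rewrite -subr_eq0; apply/eqP.
  have cE b : cont01 (fun t => expR t ^+ b) by exact: cont01X cont01_expR.
  apply: (@annihilates_exp_eq0 _ (fun t => segint (wx a%:R 0 X i ^~ t) 0 1
    - segint (wx a%:R 0 Y i ^~ t) 0 1)) t01'.
    exact: cont01B (csec _ _ _) (csec _ _ _).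
  move=> b; under [X in segint X]eq_fun do rewrite mulrBr.
  rewrite segintB//; [|by apply: cont01M; [exact: cE|exact: csec]..].
  by rewrite -!section// moments subrr.
have cx Z (hZ : holder_surface0 rho Z) : cont01 (fun s => Z s t0 0 i).
  apply: (@ucont2_section _ (fun s t => Z s t 0 i)) => //.
  by apply: (holder_ucont2 i _ (proj1 hZ)); lra.
apply/eqP; rewrite -subr_eq0; apply/eqP.
(* Injectivity in [s]: at the fixed height [t0], the equalities [kt] for all [a] are the exponential
   moments of the difference. *)
apply: (@annihilates_exp_eq0 _ (fun s => X s t0 0 i - Y s t0 0 i)) s01.
  exact: cont01B (cx _ _) (cx _ _).
move=> a; have cE : cont01 (fun s : R => expR s ^+ a).
  exact: cont01X cont01_expR.
under [X in segint X]eq_fun do rewrite mulrBr.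
rewrite segintB//; [|by apply: cont01M; [exact: cE|exact: cx]..].
apply/eqP; rewrite subr_eq0; apply/eqP; have := kt a t0 t01.
rewrite /wx /exp_weight.
under eq_segint => s _ do rewrite mul0r addr0 expRM_natl.
by under [in RHS]eq_segint => s _ do rewrite mul0r addr0 expRM_natl.
Qed.
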